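(* Let $(q_k)_{k\in\mathbb N}$ be a sequence of monic polynomials $q_k\in\mathbb C[z]$ of degrees $n_k>0$ with $n_k\to\infty$, and let $\mu_k$ denote the root distribution of $q_k$. Suppose that $(\mu_k)_k$ converges weak* to a compactly supported Borel probability measure $\mu$ on $\mathbb C$. Let $U\subset\mathbb C$ be an open set which is root-sparse for $(q_k)_k$ and on which the potential $p_\mu$ is nowhere locally constant. Then for every $m=0,1,2,\ldots$ $$\xi_{k,m}-\xi_k\ \longrightarrow\ m\,\xi_{p_\mu'}\quad\text{on } U\text{ as } k\to\infty,$$ where $\xi_{k,m}=\xi_{q_k^{(m)}}$ is the divisor on $U$ of the $m$th derivative $q_k^{(m)}$, $\xi_k=\xi_{q_k}$ is the divisor on $U$ of $q_k$, and $\xi_{p_\mu'}$ is the divisor on $U$ of the holomorphic function $p_\mu'$; that is, for every $\phi\in\mathscr C_c(U)$, $\ \xi_{k,m}(\phi)-\xi_k(\phi)\to m\,\xi_{p_\mu'}(\phi)$ as $k\to\infty$.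
   Context: Write $q_k(z)=\prod_{j=1}^{n_k}(z-z_{k,j})$, roots repeated with multiplicity. The root-counting measure of $q_k$ is $\mu_k^\#=\sum_{j=1}^{n_k}\delta_{z_{k,j}}$, and the root distribution is the probability measure $\mu_k=\frac1{n_k}\mu_k^\#$. Weak* convergence $\mu_k\to\mu$ is as probability measures on the Riemann sphere $\widehat{\mathbb C}$, i.e. $\int f\,d\mu_k\to\int f\,d\mu$ for every continuous $f$ on $\widehat{\mathbb C}$. An open set $U\subset\mathbb C$ is root-sparse for $(q_k)_k$ if for every compact $K\subset U$ there is $M=M(K)$ with $\mu_k^\#(K)\le M$ for all sufficiently large $k$. The potential of a finite compactly supported Borel measure $\mu$ is $p_\mu(z)=\int\log|z-w|\,d\mu(w)$; it is harmonic off the support of $\mu$. (A root-sparse open set does not meet the support of a weak* limit of $(\mu_k)_k$, so $p_\mu$ is harmonic on $U$.) For a harmonic function $h:U\to\mathbb R$, put $h'=2\frac{\partial h}{\partial z}=\left(\frac{\partial}{\partial x}-i\frac{\partial}{\partial y}\right)h$ with $z=x+iy$; $h'$ is holomorphic. ''Nowhere locally constant on $U$'' means not constant on any nonempty open subset of $U$. A divisor on an open set $U$ is a map $\xi:U\to\mathbb Z$ such that $\{z:\xi(z)\ne0\}$ has no accumulation points in $U$. $\mathscr C_c(U)$ is the space of continuous functions with compact support in $U$; a divisor acts on $\phi\in\mathscr C_c(U)$ by $\xi(\phi)=\sum_z\xi(z)\phi(z)$ (a finite sum). Convergence $\xi_k\to\xi$ of divisors on $U$ means $\xi_k(\phi)\to\xi(\phi)$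 for every $\phi\in\mathscr C_c(U)$. For a holomorphic function $f$ on $U$ that is not identically zero on any component of $U$, its divisor $\xi_f$ is given by $\xi_f(z)=$ the order of the zero of $f$ at $z$ (and $0$ if $f(z)\neq0$). For given $m$, $\xi_{k,m}$ is considered only for $k$ large enough that $q_k^{(m)}\not\equiv0$ (all but finitely many $k$). *)

(* Defs.v *)
From HB Require Import structures.
From mathcomp Require Import all_boot all_order all_algebra.
From mathcomp Require Import all_classical all_reals all_analysis.
From mathcomp Require Import complex.

Set Implicit Arguments.
Unset Strict Implicit.
Unset Printing Implicit Defensive.

Import Order.TTheory GRing.Theory Num.Theory.
Import numFieldTopology.Exports numFieldNormedType.Exports.

Local Open Scope classical_set_scope.
Local Open Scope ring_scope.
Local Open Scope complex_scope.

(* R[i] carries no topology of its own here; R[i]^o is R[i] as a normed space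
   over itself, with the usual topology of the plane and with complex
   differentiation. *)
Notation plane R := (R[i]^o).

(* The points of the plane, with the Borel sigma-algebra. *)
Notation borel_plane R := (g_sigma_algebraType (@open (plane R))).

(* None is the point at infinity. *)
Notation sphere R := (one_point_compactification (plane R)).

Section Roots.
Context {R : realType}.
Implicit Types (p : {poly R[i]}) (q : nat -> {poly R[i]}).

(* For p != 0, the list of the roots of p repeated with multiplicity (in an
   unspecified order): p = lead_coef p *: \prod_(z <- poly_roots p) ('X - z%:P) *)
Definition poly_roots p : seq R[i] := sval (closed_field_poly_normal p).

Definition root_counting p : {measure set (borel_plane R) -> \bar R} :=
  msum (fun j => \d_((poly_roots p)`_j : borel_plane R)) (size (poly_roots p)).

(* (size p).-1 is the degree of p. *)
Definition root_distribution p : {measure set (borel_plane R) -> \bar R} :=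
  mscale (((size p).-1)%:R^-1)%:nng (root_counting p).

Definition root_sparse q (U : set (plane R)) : Prop :=
  forall K : set (plane R), compact K -> K `<=` U ->
    exists M : R, \forall k \near \oo, (root_counting (q k) K <= M%:E)%E.

End Roots.

Section Measures.
Context {R : realType}.
Implicit Types mu : {measure set (borel_plane R) -> \bar R}.

(* Measures on the plane are regarded as measures on the sphere giving no mass
   to the point at infinity, so that the integral of f over the sphere is the
   integral over the plane of z |-> f (Some z). *)
Definition weak_star_cvg (mu_ : nat -> {measure set (borel_plane R) -> \bar R})
    mu : Prop :=
  forall f : sphere R -> R, continuous f ->
    (\int[mu_ k]_z f (Some z))%R @[k --> \oo] --> (\int[mu]_z f (Some z))%R.

Definition measure_support mu : set (plane R) :=
  [set z | forall V : set (plane R), open V -> V z -> (0 < mu V)%E].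

(* lne 0 = -oo, so this is the extended real-valued logarithmic potential;
   `|z - w| is a (real) element of R[i]. *)
Definition potential mu (z : plane R) : \bar R :=
  (\int[mu]_w lne (complex.Re `|z - w|)%:E)%E.

End Measures.

Section Functions.
Context {R : realType}.

Definition nowhere_locally_constant (T : Type) (U : set (plane R))
    (h : plane R -> T) : Prop :=
  forall V : set (plane R), open V -> V !=set0 -> V `<=` U ->
    ~ exists c : T, forall z, V z -> h z = c.

(* (d/dx - i d/dy) h *)
Definition two_dz (h : plane R -> R) (z : plane R) : plane R :=
  (derive1 (fun t : R => h (z + t%:C)) 0)%:C
  - 'i * (derive1 (fun t : R => h (z + 'i * t%:C)) 0)%:C.

Definition potential_deriv (mu : {measure set (borel_plane R) -> \bar R}) :
  plane R -> plane R := two_dz (fun z => fine (potential mu z)).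

Definition has_zero_order (f : plane R -> plane R) (z : plane R) (n : nat) : Prop :=
  exists g : plane R -> plane R,
    [/\ \forall w \near z, derivable g w 1, g z != 0
      & \forall w \near z, f w = (w - z) ^+ n * g w].

(* The order is unique when it exists; it exists when f is holomorphic and not
   identically zero near z. *)
Definition zero_order (f : plane R -> plane R) (z : plane R) : nat :=
  xget 0%N [set n | has_zero_order f z n].

End Functions.

Section Divisors.
Context {R : realType}.
Implicit Types (U : set (plane R)) (xi : plane R -> int).

Definition is_divisor U xi : Prop :=
  forall z, U z -> ~ limit_point [set w | U w /\ xi w != 0] z.

Definition divisor_of (f : plane R -> plane R) : plane R -> int :=
  fun z => (zero_order f z)%:Z.

Definition compactly_supported_in U (phi : plane R -> plane R) : Prop :=
  [/\ continuous phi, compact (closure [set z | phi z != 0])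
    & closure [set z | phi z != 0] `<=` U].

(* The sum ranges over the (finite) set of the z in U where the summand does
   not vanish. *)
Definition divisor_act U xi (phi : plane R -> plane R) : plane R :=
  \sum_(z \in U) (xi z)%:~R * phi z.

Definition divisor_cvg U (xi_ : nat -> plane R -> int) xi : Prop :=
  [/\ \forall k \near \oo, is_divisor U (xi_ k),
      is_divisor U xi
    & forall phi, compactly_supported_in U phi ->
        divisor_act U (xi_ k) phi @[k --> \oo] --> divisor_act U xi phi].

End Divisors.

(* Main.v *)
Require Import Defs.
From mathcomp Require Import all_boot all_order all_algebra.
From mathcomp Require Import all_classical all_reals all_analysis.
From mathcomp Require Import complex measurable_realfun.
From mathcomp Require Import ring lra zify.

Import Order.TTheory GRing.Theory Num.Theory.
Import numFieldTopology.Exports numFieldNormedType.Exports.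
Import Normc.

Set Implicit Arguments.
Unset Strict Implicit.
Unset Printing Implicit Defensive.

Local Open Scope classical_set_scope.
Local Open Scope ring_scope.
Local Open Scope complex_scope.

(** The limit may be taken along an arbitrary ultrafilter F finer than [\oo]
([cvg_ultra]). This replaces every extraction of a subsequence: along F a
bounded sequence in the plane converges, and a bounded sequence of integers is
eventually constant.

Fix z0 in U. A small disc around z0 contains boundedly many roots of q_k, so
along F the number of roots in each sufficiently small disc around z0 is a
constant d: exactly d roots tend to z0 and the others keep a distance r0 from it
([cluster_count_ex]). For a function f bounded outside the disc, the sum
of f over the distant roots, divided by n_k = deg q_k, has a limit [outer_lim]
along F, which is a positive linear functional of f and does the work of
integration against mu. Testing weak* convergence against a tent function shows
that mu does not charge the disc, and testing it against truncated logarithms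
gives p(z) - p(z0) = lim E (ln|z-w| - ln|z0-w|) for z near z0
([potential_diff_outer_lim]), where E is this mean over the distant roots w. The
quadratic estimate ln|1+u| = Re u + O(|u|^2) then identifies p'(z) with the
Cauchy transform g(z) = lim E 1/(z-w) ([two_dz_potential]). Expanding the Cauchy
kernel at z0 up to the first moment lim E (w-z0)^-(e+1) that does not vanish gives
g(z) = (z-z0)^e h(z) with h holomorphic and h(z0) <> 0. Such an e exists, since
otherwise g = 0 and p would be constant near z0 ([cauchy0_eq0],
[potential_constant]); hence e is the order of p' at z0 ([zero_order_two_dz]).

It remains to see that d + m e roots of the m-th derivative tend to z0
([cluster_count_derivn]). Off the roots, q^(m)/q is m! times the m-th elementary
symmetric function of the numbers 1/(z-w), and the power sums of these numbers,
divided by n_k, converge on a small circle around z0: the i-th one to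
lim E (z-w)^-i, as the d roots near z0 disappear in the mean. By Newton's
identities the ratio q^(m) / (n^m q) tends to g^m, and one order further the
difference of the logarithmic derivatives of q^(m) and q tends to m g'/g
([cvg_logderiv_derivn]). Since (z-z0) g'/g is close to e on a small circle, the
argument principle says that q^(m) has m e more roots than q inside that circle.
The argument principle needed here is elementary: averaging u f'(z0+u)/f(z0+u)
over the N-th roots u of r^N and letting N tend to infinity counts the roots
of the polynomial f in the disc ([disc_count_diff]).

Finally, if the roots of a sequence of polynomials form a cluster of c(z) roots at
every z in U, the sums of phi over these roots tend to the sum of c(z) phi(z)
([cvg_cluster_sum]); subtracting the cases c = d + m e and c = d yields m e. *)

(** * The plane as a real normed space *)

Section Plane.
Context {R : realType}.
Local Notation C := (plane R).
Implicit Types (z w : C) (r e : R).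

Lemma normcE z : `|z| = (normc z)%:C.
Proof. by []. Qed.

Lemma normc_ge0 z : 0 <= normc z.
Proof. by rewrite -ler0c -normcE. Qed.

Lemma normcD z w : normc (z + w) <= normc z + normc w.
Proof. by rewrite -lecR rmorphD /= -!normcE ler_normD. Qed.

Lemma normcB z w : normc (z - w) = normc (w - z).
Proof. by rewrite -normcN opprB. Qed.

Lemma normc_dist_le z w u : normc (z - w) <= normc (z - u) + normc (u - w).
Proof. by have := normcD (z - u) (u - w); rewrite subrKA. Qed.

Lemma normc_eq0 z : (normc z == 0) = (z == 0).
Proof. by apply/eqP/eqP => [/eq0_normc//|->]; exact: normc0. Qed.

Lemma normc_gt0 z : (0 < normc z) = (z != 0).
Proof. by rewrite lt_neqAle normc_ge0 andbT eq_sym normc_eq0. Qed.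

Lemma normc_real (x : R) : normc (x%:C : C) = `|x|.
Proof. by rewrite /normc/= expr0n /= addr0 sqrtr_sqr. Qed.

Lemma normcX z n : normc (z ^+ n) = normc z ^+ n.
Proof. by elim: n => [|n ih]; rewrite ?expr0 ?normc1// !exprS normcM ih. Qed.

Lemma normc_div z w : normc (z / w) = normc z / normc w.
Proof. by rewrite normcM normcV. Qed.

Lemma normc_nat n : normc (n%:R : C) = n%:R.
Proof. by rewrite -(rmorph_nat (real_complex R)) normc_real ger0_norm. Qed.

Lemma normc_sum (I : Type) (s : seq I) (P : pred I) (f : I -> C) :
  normc (\sum_(i <- s | P i) f i) <= \sum_(i <- s | P i) normc (f i).
Proof.
elim/big_ind2 : _ => [|x1 x2 y1 y2 h1 h2|//]; first by rewrite normc0.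
by apply: (le_trans (normcD _ _)); exact: lerD.
Qed.

Lemma normc_Re z : `|complex.Re z| <= normc z.
Proof. by rewrite -lecR -normcE; exact: normc_ge_Re. Qed.

Lemma normc_Im z : `|complex.Im z| <= normc z.
Proof.
case: z => a b /=; rewrite -sqrtr_sqr ler_sqrt ?lerDr ?sqr_ge0//.
by rewrite addr_ge0 ?sqr_ge0.
Qed.

(** The norm of the plane takes its values in R[i], so that the epsilons of its
topology are complex numbers; these are the same limits with real epsilons. *)
Lemma cvg_normcP (T : Type) (F : set_system T) {FF : Filter F} (f : T -> C) l :
  f @ F --> l <-> forall e, 0 < e -> \forall x \near F, normc (l - f x) < e.
Proof.
split=> [/cvgrPdist_lt h e e0|h].
  have := h e%:C; rewrite ltcR => /(_ e0).
  by apply: filterS => x; rewrite normcE ltcR.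
apply/cvgrPdist_lt => e e0.
have er : e = (complex.Re e)%:C by rewrite RRe_real // gtr0_real.
by move: e0; rewrite er ltcR => /h; apply: filterS => x; rewrite normcE ltcR.
Qed.

Section Limits.
Variables (T : Type) (F : set_system T).
Context {FF : Filter F}.
Implicit Types (f g : T -> C) (a b : C).

Lemma cvg_addC f g a b :
  f @ F --> a -> g @ F --> b -> (fun x => f x + g x : C) @ F --> (a + b : C).
Proof. by move=> fa gb; exact: (cvgD fa gb). Qed.

Lemma cvg_subC f g a b :
  f @ F --> a -> g @ F --> b -> (fun x => f x - g x : C) @ F --> (a - b : C).
Proof. by move=> fa gb; exact: (cvgB fa gb). Qed.

Lemma cvg_mulC f g a b :
  f @ F --> a -> g @ F --> b -> (fun x => f x * g x : C) @ F --> (a * b : C).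
Proof. by move=> fa gb; exact: (@cvgM R[i] _ _ _ f g a b fa gb). Qed.

Lemma cvg_invC f a :
  a != 0 -> f @ F --> a -> (fun x => (f x)^-1 : C) @ F --> (a^-1 : C).
Proof. by move=> a0 fa; exact: (@cvgV R[i] _ _ _ f a a0 fa). Qed.

Lemma cvg_expC f a n : f @ F --> a -> (fun x => f x ^+ n : C) @ F --> (a ^+ n : C).
Proof.
move=> fa; elim: n => [|n ih].
  by under eq_fun do rewrite expr0; rewrite expr0; exact: cvg_cst.
by under eq_fun do rewrite exprS; rewrite exprS; exact: (cvg_mulC fa ih).
Qed.

Lemma cvg_sumC (I : Type) (s : seq I) (P : pred I) (f : I -> T -> C) (l : I -> C) :
  (forall i, P i -> f i @ F --> l i) ->
  (fun x => \sum_(i <- s | P i) f i x) @ F --> (\sum_(i <- s | P i) l i : C).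
Proof.
move=> fl; elim: s => [|a s ih].
  by under eq_fun do rewrite big_nil; rewrite big_nil; exact: cvg_cst.
under eq_fun do rewrite big_cons; rewrite big_cons.
by case: ifPn => [Pa|_]; [exact: (cvg_addC (fl a Pa) ih)|exact: ih].
Qed.

(** In applications g is 1/n_k and f a sum over the boundedly many roots in a disc. *)
Lemma cvg0_bounded f (g : T -> C) r :
  g @ F --> (0 : C) -> (\forall x \near F, normc (f x) <= r) ->
  (fun x => f x * g x : C) @ F --> (0 : C).
Proof.
move=> /cvg_normcP g0 fr; apply/cvg_normcP => e e0.
have r0 : 0 < `|r| + 1 by rewrite ltr_pwDr.
have := g0 _ (divr_gt0 e0 r0); apply: filterS2 fr => x fx.
rewrite !sub0r !normcN normcM ltr_pdivlMr// => gx.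
apply: le_lt_trans gx; rewrite mulrC ler_wpM2l ?normc_ge0//.
by apply: le_trans fx _; rewrite (le_trans (ler_norm r))// lerDl.
Qed.

End Limits.

Definition disc z r : set C := [set w | normc (w - z) < r].

Lemma nbhs_discP z (A : set C) :
  nbhs z A <-> exists2 r, 0 < r & disc z r `<=` A.
Proof.
split=> [zA|[r r0 rA]].
  case/nbhs_ballP: zA => e /= e0 eA.
  have er : e = (complex.Re e)%:C by rewrite RRe_real // gtr0_real.
  exists (complex.Re e); first by move: e0; rewrite er ltcR.
  move=> w wz; apply: eA; rewrite -ball_normE /ball_ /= er normcE ltcR.
  by rewrite normcB.
have [+ _] := @cvg_normcP _ (nbhs z) (nbhs_filter z) id z.
move=> /(_ (@cvg_id _ _) _ r0).
by apply: filterS => w zw; apply: rA; rewrite /disc/= normcB.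
Qed.

Lemma nbhs_disc z r : 0 < r -> nbhs z (disc z r).
Proof. by move=> r0; apply/nbhs_discP; exists r. Qed.

Lemma continuous_contraction (f : C -> R) :
  (forall z w, `|f z - f w| <= normc (z - w)) -> continuous f.
Proof.
move=> fc z; apply/(cvgrPdist_lt (FF := nbhs_filter z)) => e e0.
apply: filterS (nbhs_disc z e0) => w wz.
by apply: le_lt_trans wz; rewrite normcB.
Qed.

Lemma continuous_normc (c : C) : continuous (fun w : C => normc (w - c)).
Proof.
apply: continuous_contraction => z w; rewrite ler_norml.
have := normc_dist_le z c w; have := normc_dist_le w c z.
by rewrite (normcB w z); lra.
Qed.

Lemma continuous_Re : continuous (@complex.Re R : C -> R).
Proof.
apply: continuous_contraction => z w; apply: le_trans (normc_Re (z - w)).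
by case: z w => [? ?] [? ?].
Qed.

Lemma continuous_real_complex : continuous (real_complex R : R -> C).
Proof.
move=> x; apply/cvg_normcP => e e0; have [+ _] := cvgrPdist_lt (FF := nbhs_filter x) id x.
move=> /(_ (@cvg_id _ _) _ e0).
by apply: filterS => y; rewrite /= -normc_real rmorphB.
Qed.

Lemma closed_cdisc z r : closed [set w : C | normc (w - z) <= r].
Proof.
apply: (@closed_comp _ _ (fun w : C => normc (w - z)) [set x : R | x <= r]).
  by move=> w _; exact: continuous_normc.
exact: closed_le.
Qed.

Lemma open_disc z r : open (disc z r).
Proof.
apply: (@open_comp _ _ (fun w : C => normc (w - z)) [set x : R | x < r]).
  by move=> w _; exact: continuous_normc.
exact: open_lt.
Qed.

(** The square containing the disc is the image of a product of segments. *)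
Lemma compact_cdisc z r : compact [set w : C | normc (w - z) <= r].
Proof.
pose f (xy : R * R) : C := xy.1%:C + 'i * xy.2%:C.
have cf : continuous f.
  move=> xy; apply: (@cvgD R[i] C).
    apply: (cvg_comp _ _ (@cvg_fst _ _ (nbhs xy.1) (nbhs xy.2) _)).
    exact: continuous_real_complex.
  apply: (@cvgMr R[i]).
  apply: (cvg_comp _ _ (@cvg_snd _ _ (nbhs xy.1) (nbhs xy.2) _)).
  exact: continuous_real_complex.
pose Q := f @` (`[complex.Re z - r, complex.Re z + r] `*`
                `[complex.Im z - r, complex.Im z + r]).
have cQ : compact Q.
  apply: continuous_compact.
    exact: continuous_subspaceT.
  by apply: compact_setX; exact: segment_compact.
apply: (subclosed_compact _ cQ); first exact: closed_cdisc.
move=> w /= wr.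
exists (complex.Re w, complex.Im w); last by rewrite /f /= -complexE.
have := le_trans (normc_Re _) wr; have := le_trans (normc_Im _) wr.
case: (z) (w) => [a b] [c d] /=; rewrite !in_itv/= !ler_norml => h1 h2.
by split; lra.
Qed.

Lemma ultra_fmap (T S : Type) (F : set_system T) (f : T -> S) :
  UltraFilter F -> UltraFilter (f @ F).
Proof.
move=> FU; split=> [|G GF FG]; first exact: fmap_proper_filter.
apply/seteqP; split => // A GA.
have [//|FnA] := in_ultra_setVsetC (f @^-1` A) FU.
have /(filterI GA) : G (~` A) by exact: FG.
by rewrite setICr => /filter_not_empty.
Qed.

(** Closed discs are compact, hence contain the limit of every ultrafilter on them. *)
Lemma ultra_cvg_bounded (T : Type) (F : set_system T) (f : T -> C) r :
  UltraFilter F -> (\forall x \near F, normc (f x) <= r) ->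
  exists2 l : C, normc l <= r & f @ F --> l.
Proof.
move=> FU fr; have := compact_cdisc (z := 0) (r := r); rewrite compact_ultra.
move=> /(_ (f @ F) _) [||l [/= lr fl]].
- exact: ultra_fmap.
- by apply: filterS fr => x /=; rewrite subr0.
- by exists l; rewrite // -(subr0 l).
Qed.

End Plane.

(** * Orders of zeros *)

Section ZeroOrder.
Context {R : realType}.
Local Notation C := (plane R).
Implicit Types (z w : C) (p : {poly R[i]}).

Lemma derivable_continuous (f : C -> C) z :
  derivable f z 1 -> {for z, continuous f}.
Proof. by move=> /derivable1_diffP; exact: differentiable_continuous. Qed.

(** Two factorisations of different orders m < n give g(w) = (w-z)^(n-m) h(w) off z,
and g(z) = 0 by continuity. *)
Lemma has_zero_order_unique (f : C -> C) z m n :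
  has_zero_order f z m -> has_zero_order f z n -> m = n.
Proof.
wlog mn : m n / (m < n)%N => [h hm hn|].
  case: (ltngtP m n) => // mn; first exact: h.
  by apply/esym/h.
move=> [g [dg gz fg]] [h [dh hz fh]]; exfalso.
have cg : g @ z^' --> g z.
  apply: cvg_within_filter.
  exact: (derivable_continuous (nbhs_singleton dg)).
have cX : (fun w => (w - z) ^+ (n - m) * h w) @ z --> (0 : C).
  have z0 : (z - z : C) ^+ (n - m) = 0.
    by rewrite subrr expr0n subn_eq0 leqNgt mn.
  rewrite -(mul0r (h z)) -[X in X * _]z0.
  have ch := derivable_continuous (nbhs_singleton dh).
  apply: (cvg_mulC _ ch); apply: (cvg_expC (F := nbhs z)).
  exact: (cvg_subC (F := nbhs z) cvg_id (cvg_cst _)).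
have cX' : (fun w => (w - z) ^+ (n - m) * h w) @ z^' --> (0 : C).
  exact: cvg_within_filter cX.
have : g @ z^' --> (0 : C).
  apply: (cvg_trans _ cX'); apply: near_eq_cvg.
  have E : \forall w \near z, w != z -> (w - z) ^+ (n - m) * h w = g w.
    near=> w; move=> wz.
    have fgw : f w = (w - z) ^+ m * g w by near: w.
    have fhw : f w = (w - z) ^+ n * h w by near: w.
    have wmn : (w - z) ^+ m * ((w - z) ^+ (n - m) * h w) = (w - z) ^+ m * g w.
      by rewrite mulrA -exprD subnKC ?(ltnW mn)// -fgw -fhw.
    by apply: (mulfI _ wmn); rewrite expf_neq0// subr_eq0.
  exact: E.
move=> /(cvg_unique (@norm_hausdorff _ C) cg) g0.
by rewrite g0 eqxx in gz.
Unshelve. all: by end_near. Qed.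

Lemma poly_rootsE p : p = lead_coef p *: \prod_(w <- poly_roots p) ('X - w%:P).
Proof. exact: (svalP (closed_field_poly_normal p)). Qed.

Lemma derivable_hornerC p z : derivable (horner p : C -> C) z 1.
Proof.
elim/poly_ind: p => [|p c ih].
  by rewrite (_ : horner 0 = cst 0) //; apply/funext => w; rewrite horner0.
have id : derivable (id : C -> C) z 1 by exact: derivable_id.
have h := @derivableM R[i] C (horner p : C -> C) idfun z 1 ih id.
have := @derivableD R[i] C C _ _ z 1 h (derivable_cst (c : C) z 1).
by rewrite [X in derivable X](_ : _ = horner (p * 'X + c%:P) :> (C -> C))//;
  apply/funext => w; rewrite hornerMXaddC.
Qed.

Lemma zero_order_unique (f : C -> C) z n :
  has_zero_order f z n -> zero_order f z = n.
Proof.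
move=> fn; apply: (has_zero_order_unique _ fn).
exact: (@xgetPex _ _ [set n | has_zero_order f z n] (ex_intro _ n fn)).
Qed.

Lemma zero_order_horner p z :
  p != 0 -> zero_order (horner p) z = count_mem z (poly_roots p).
Proof.
move=> p0; apply: zero_order_unique.
(* The factors other than 'X - z. *)
pose q := lead_coef p *: \prod_(w <- poly_roots p | w != z) ('X - w%:P).
exists (horner q); split.
- by apply: (nearW (F := nbhs z)) => w; exact: derivable_hornerC.
- rewrite hornerZ mulf_eq0 lead_coef_eq0 (negbTE p0) /= horner_prod.
  rewrite prodf_seq_eq0; apply/hasPn => w _.
  by rewrite hornerXsubC subr_eq0 (eq_sym z) andNb.
- near=> w; rewrite {1}(poly_rootsE p) !hornerZ mulrCA; congr (_ * _).
  rewrite !horner_prod (bigID (pred1 z)) /=; congr (_ * _).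
  rewrite (eq_bigr (fun=> w - z)) => [|u /eqP ->]; last by rewrite hornerXsubC.
  by rewrite big_const_seq iter_mulr_1.
Unshelve. all: by end_near. Qed.

End ZeroOrder.

(** * Power sums and the derivatives of a polynomial *)

Section Newton.
Variable F : fieldType.
Implicit Types (us ws : seq F) (z : F).

Definition psum us i : F := \sum_(u <- us) u ^+ i.
(** The m-th elementary symmetric function of the entries of us, as a coefficient of
the product of the 1 + u X. *)
Definition esym us m : F := (\prod_(u <- us) (1 + u *: 'X : {poly F}))`_m.

Lemma esym_nil m : esym [::] m = (m == 0%N)%:R.
Proof. by rewrite /esym big_nil coef1. Qed.

Lemma esym_cons u us m :
  esym (u :: us) m = esym us m + u * (if m is m'.+1 then esym us m' else 0).
Proof.
rewrite /esym big_cons mulrDl mul1r coefD -scalerAl coefZ coefXM.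
by case: m.
Qed.

(** By induction on the number of entries. Adding the entry u changes both sides by
terms that the induction hypothesis accounts for, up to a sum which telescopes. *)
Lemma newton us m :
  m.+1%:R * esym us m.+1 =
  \sum_(i < m.+1) (-1) ^+ i * psum us i.+1 * esym us (m - i).
Proof.
elim: us m => [|u us ih] m.
  rewrite esym_nil mulr0 big1 // => i _.
  by rewrite /psum big_nil mulr0 mul0r.
have psum_cons i : psum (u :: us) i = psum us i + u ^+ i.
  by rewrite /psum big_cons addrC.
pose e' k := if k is k'.+1 then esym us k' else 0.
have ec k : esym (u :: us) k = esym us k + u * e' k by exact: esym_cons.
under eq_bigr do rewrite psum_cons ec.
have -> : \sum_(i < m.+1) (-1) ^+ i * (psum us i.+1 + u ^+ i.+1) *
            (esym us (m - i) + u * e' (m - i)%N) =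
  \sum_(i < m.+1) (-1) ^+ i * psum us i.+1 * esym us (m - i) +
  u * (\sum_(i < m.+1) (-1) ^+ i * psum us i.+1 * e' (m - i)%N) +
  \sum_(i < m.+1) (-1) ^+ i * u ^+ i.+1 * (esym us (m - i) + u * e' (m - i)%N).
  rewrite mulr_sumr -!big_split /=; apply: eq_bigr => i _; ring.
rewrite -ih.
have -> : \sum_(i < m.+1) (-1) ^+ i * psum us i.+1 * e' (m - i)%N =
          m%:R * esym us m.
  case: m => [|m]; first by rewrite big_ord_recl big_ord0 subnn /= mulr0 addr0 mul0r.
  rewrite big_ord_recr /= subnn mulr0 addr0 ih; apply: eq_bigr => i _.
  by rewrite subSn // -ltnS.
have -> : \sum_(i < m.+1) (-1) ^+ i * u ^+ i.+1 *
            (esym us (m - i) + u * e' (m - i)%N) = u * esym us m.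
  (* The guard makes f m.+1 vanish, where m - i would be truncated to 0. *)
  pose f i := - ((-1) ^+ i * u ^+ i.+1 *
                 (if (i <= m)%N then esym us (m - i) else 0)).
  rewrite (eq_bigr (fun i : 'I_m.+1 => f i.+1 - f i)) => [|[i /=]]; last first.
    rewrite ltnS /f => im _; rewrite im; case: (ltnP i m) => im'.
      have -> : (m - i = (m - i.+1).+1)%N by lia.
      by rewrite /= !exprS; ring.
    have -> : (m - i = 0)%N by lia.
    by rewrite /= !mulr0 oppr0 opprK add0r addr0.
  rewrite -(big_mkord xpredT (fun i => f i.+1 - f i)) telescope_sumr//.
  by rewrite /f ltnn leq0n subn0 mulr0 oppr0 add0r opprK mul1r expr1.
by rewrite ec /= -[m.+1%:R]natr1; ring.
Qed.

Lemma derivn_mulXsubC (p : {poly F}) z m :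
  (('X - z%:P) * p)^`(m.+1) = ('X - z%:P) * p^`(m.+1) + p^`(m) *+ m.+1.
Proof.
elim: m => [|m ih]; first by rewrite derivn1 derivM derivXsubC mul1r addrC derivn0 mulr1n.
rewrite derivnS ih derivD derivM derivXsubC mul1r derivMn -!derivnS.
by rewrite addrAC [RHS]addrC -mulrS addrC.
Qed.

(** Each way of differentiating m distinct linear factors, in one of m! orders,
contributes the value of the product times the 1/(z-w) for the chosen roots w. *)
Lemma derivn_prodXsubC ws z m : z \notin ws ->
  (\prod_(w <- ws) ('X - w%:P))^`(m).[z] =
  (\prod_(w <- ws) ('X - w%:P)).[z] * m`!%:R *
  esym [seq (z - w)^-1 | w <- ws] m.
Proof.
elim: ws m => [|w ws ih] m; rewrite ?inE ?negb_or.
  rewrite esym_nil big_nil !hornerE; case: m => [|m].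
    by rewrite derivn0 hornerE fact0 !mulr1.
  by rewrite derivSn -polyC1 derivC linear0 horner0 mulr0.
move=> /andP[zw zws]; rewrite /= esym_cons !big_cons hornerM hornerXsubC.
have zw0 : z - w != 0 by rewrite subr_eq0.
case: m => [|m].
  by rewrite derivn0 hornerM hornerXsubC mulr0 addr0 -!mulrA [_ * (_ * esym _ _)]mulrA -ih.
rewrite derivn_mulXsubC hornerD hornerM hornerXsubC hornerMn !ih// factS natrM.
by rewrite -mulr_natl; field; exact: zw0.
Qed.

(** The case m = 1 of the formula for the derivatives: the first elementary symmetric
function is the first power sum. *)
Lemma logderiv_prodXsubC ws z : z \notin ws ->
  (\prod_(w <- ws) ('X - w%:P))^`().[z] / (\prod_(w <- ws) ('X - w%:P)).[z] =
  \sum_(w <- ws) (z - w)^-1.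
Proof.
move=> zws; rewrite -derivn1 derivn_prodXsubC// [1`!]/= mulr1.
have p0 : (\prod_(w <- ws) ('X - w%:P)).[z] != 0.
  by rewrite -rootE root_prod_XsubC.
have := newton [seq (z - w)^-1 | w <- ws] 0.
rewrite big_ord_recl big_ord0 !mul1r addr0 subnn => ->.
have -> : esym [seq (z - w)^-1 | w <- ws] 0 = 1.
  by elim: (ws) => [|w s ih]; rewrite /= ?esym_nil// esym_cons mulr0 addr0.
by rewrite mulr1 mulrAC divff// mul1r /psum big_map.
Qed.

End Newton.

(** * A discrete argument principle *)

Section ArgumentPrinciple.
Context {R : realType}.
Local Notation C := (plane R).
Implicit Types (z w u e : C) (r : R) (p : {poly R[i]}).

Lemma mem_poly_roots p z : p != 0 -> (z \in poly_roots p) = root p z.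
Proof.
move=> p0; rewrite [in RHS](poly_rootsE p) rootZ ?lead_coef_eq0//.
by rewrite root_prod_XsubC.
Qed.

Lemma logderiv_horner p z : p.[z] != 0 ->
  p^`().[z] / p.[z] = \sum_(w <- poly_roots p) (z - w)^-1.
Proof.
move=> pz; have p0 : p != 0 by apply: contraNneq pz => ->; rewrite horner0.
rewrite -logderiv_prodXsubC; last by rewrite mem_poly_roots.
rewrite {1 2}(poly_rootsE p) derivZ !hornerZ -mulf_div divff ?mul1r//.
by rewrite lead_coef_eq0.
Qed.

Definition circle_points r n : seq C := poly_roots ('X^n - (r%:C ^+ n)%:P).

Lemma circle_poly_monic r n : (0 < n)%N ->
  'X^n - ((r%:C : C) ^+ n)%:P \is monic.
Proof. by move=> n0; rewrite monicXnsubC. Qed.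

Lemma size_circle_points r n : (0 < n)%N -> size (circle_points r n) = n.
Proof.
move=> n0; have := poly_rootsE ('X^n - ((r%:C : C) ^+ n)%:P).
move=> /(congr1 (fun p : {poly R[i]} => size p)).
rewrite size_XnsubC// (monicP (circle_poly_monic r n0)) scale1r.
by rewrite size_prod_XsubC => -[].
Qed.

Lemma normc_circle_points r n u : 0 < r -> (0 < n)%N ->
  u \in circle_points r n -> normc u = r.
Proof.
move=> r0 n0; rewrite mem_poly_roots ?monic_neq0 ?circle_poly_monic//.
rewrite rootE !hornerE subr_eq0 => /eqP /(congr1 (@normc R)).
rewrite !normcX normc_real ger0_norm ?ltW// => /eqP.
by rewrite eqrXn2 ?normc_ge0 ?ltW// => /eqP.
Qed.

(** Write z/(z-u) = 1 - u/(u-z): the sum of the 1/(u-z) is the logarithmic derivative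
of X^n - r^n at u. *)
Lemma sum_circle_points r n u : 0 < r -> (0 < n)%N -> normc u != r ->
  n%:R^-1 * (\sum_(z <- circle_points r n) z / (z - u)) =
  (1 - (u / r%:C) ^+ n)^-1.
Proof.
move=> r0 n0 ur; set P := 'X^n - ((r%:C : C) ^+ n)%:P.
have rC0 : (r%:C : C) != 0 by rewrite -normc_eq0 normc_real normr_eq0 gt_eqF.
have Pu : P.[u] = u ^+ n - r%:C ^+ n by rewrite !hornerE.
have Pu0 : P.[u] != 0.
  rewrite Pu subr_eq0; apply: contra ur => /eqP /(congr1 (@normc R)).
  rewrite !normcX normc_real ger0_norm ?ltW// => /eqP.
  by rewrite eqrXn2 ?normc_ge0 ?ltW.
have nR : (n%:R : R[i]) != 0 by rewrite pnatr_eq0 -lt0n.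
have uz z : z \in circle_points r n -> z - u != 0.
  move=> /(normc_circle_points r0 n0) zr.
  by rewrite subr_eq0; apply: contra ur => /eqP <-; rewrite zr.
rewrite (eq_big_seq (fun z => 1 - u * (u - z)^-1)) => [|z /uz zu]; last first.
  by rewrite -(opprB z u) invrN mulrN opprK; field; exact: zu.
rewrite sumrB -mulr_sumr -logderiv_horner// big_const_seq count_predT.
rewrite size_circle_points// iter_addr_0 -/P Pu.
have -> : u * (P^`().[u] / (u ^+ n - r%:C ^+ n)) =
          n%:R * u ^+ n / (u ^+ n - r%:C ^+ n).
  rewrite mulrA derivB derivC subr0 derivXn hornerMn hornerXn.
  by rewrite mulrnAr -exprS prednK// -mulr_natl.
rewrite Pu in Pu0.
have rn0 : r%:C ^+ n != 0 :> C by rewrite expf_neq0.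
have ru0 : r%:C ^+ n - u ^+ n != 0 by rewrite -opprB oppr_eq0.
rewrite expr_div_n; field.
by rewrite rn0 Pu0 nR ru0.
Qed.

Lemma cvg_geometricC (u : C) :
  normc u < 1 -> (fun n => u ^+ n.+1) @ \oo --> (0 : C).
Proof.
move=> u1; apply/cvg_normcP => e e0.
have /cvgrPdist_lt/(_ _ e0) : (fun n => normc u ^+ n) @ \oo --> (0 : R).
  by apply: cvg_expr; rewrite ger0_norm ?normc_ge0.
apply: filterS => n; rewrite !sub0r !normcN normcX normrN ger0_norm; last first.
  by rewrite exprn_ge0 ?normc_ge0.
apply: le_lt_trans; rewrite exprS ler_piMl ?exprn_ge0 ?normc_ge0//.
exact: ltW.
Qed.

Lemma normc_lim_le (T : Type) (F : set_system T) {FF : ProperFilter F}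
    (f : T -> C) (l : C) (c : R) :
  f @ F --> l -> (\forall x \near F, normc (f x) <= c) -> normc l <= c.
Proof.
move=> /cvg_normcP fl fc; rewrite leNgt; apply/negP => cl.
have lc0 : 0 < normc l - c by rewrite subr_gt0.
have [x [lx xc]] := filter_ex (filterI (fl _ lc0) fc).
by have := normcD (l - f x) (f x); rewrite subrK leNgt; lra.
Qed.

(** The discrete form of Cauchy's formula for the constant 1. The average is
1/(1 - (u/r)^n), which tends to 1 inside the circle and to 0 outside. *)
Lemma cvg_circle_average (r : R) (u : C) : 0 < r -> normc u != r ->
  (fun n => n.+1%:R^-1 * (\sum_(z <- circle_points r n.+1) z / (z - u))) @ \oo
  --> ((normc u < r)%R%:R : C).
Proof.
move=> r0 ur; under eq_fun do rewrite sum_circle_points//.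
have rC0 : (r%:C : C) != 0 by rewrite -normc_eq0 normc_real normr_eq0 gt_eqF.
have nr : normc (r%:C : C) = r by rewrite normc_real ger0_norm ?ltW.
case: (ltgtP (normc u) r) ur => // ur _.
  have h : (fun n => (u / r%:C) ^+ n.+1) @ \oo --> (0 : C).
    apply: cvg_geometricC.
    by rewrite normc_div nr ltr_pdivrMr// mul1r.
  have -> : (true%:R : C) = (1 - 0)^-1 by rewrite subr0 invr1.
  apply: cvg_invC; first by rewrite subr0 oner_eq0.
  exact: (cvg_subC (cvg_cst _) h).
have u0 : u != 0 by rewrite -normc_gt0 (lt_trans r0).
have h : (fun n => (r%:C / u) ^+ n.+1) @ \oo --> (0 : C).
  apply: cvg_geometricC.
  by rewrite normc_div nr ltr_pdivrMr ?mul1r// normc_gt0.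
have -> : (fun n => (1 - (u / r%:C) ^+ n.+1)^-1) =
   (fun n => (r%:C / u) ^+ n.+1 * ((r%:C / u) ^+ n.+1 - 1)^-1).
  apply/funext => n; set x := u / r%:C.
  have -> : r%:C / u = x^-1 by rewrite /x invf_div.
  have x0 : x ^+ n.+1 != 0 by rewrite expf_neq0// mulf_neq0 ?invr_neq0.
  by rewrite exprVn -invfM; congr (_^-1); field.
have -> : (false%:R : C) = 0 * (0 - 1)^-1 by rewrite mul0r.
apply: (cvg_mulC h); apply: cvg_invC; first by rewrite sub0r oppr_eq0 oner_eq0.
exact: (cvg_subC h (cvg_cst _)).
Qed.

Definition disc_count (ws : seq C) z r : nat := count (fun w => normc (w - z) < r) ws.

Lemma cvg_circle_average_logderiv p z r : 0 < r -> p != 0 ->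
  (forall w, w \in poly_roots p -> normc (w - z) != r) ->
  (fun n => n.+1%:R^-1 * (\sum_(u <- circle_points r n.+1)
     u * (p^`().[z + u] / p.[z + u]))) @ \oo
  --> ((disc_count (poly_roots p) z r)%:R : C).
Proof.
move=> r0 p0 pr.
have -> : (fun n => n.+1%:R^-1 * (\sum_(u <- circle_points r n.+1)
     u * (p^`().[z + u] / p.[z + u]))) =
  (fun n => \sum_(w <- poly_roots p) n.+1%:R^-1 *
     (\sum_(u <- circle_points r n.+1) u / (u - (w - z)))).
  apply/funext => n; rewrite -mulr_sumr; congr (_ * _).
  rewrite exchange_big /=; apply: eq_big_seq => u.
  move=> /(normc_circle_points r0 (ltn0Sn _)) ur.
  rewrite logderiv_horner; last first.
    apply/negP; rewrite -[_ == 0]/(root p (z + u)) -mem_poly_roots// => /pr.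
    by rewrite addrC addKr ur eqxx.
  by rewrite mulr_sumr; apply: eq_bigr => w _; rewrite opprB addrCA addrA.
rewrite /disc_count -sum1_count natr_sum big_mkcond /=.
rewrite [X in _ --> X](_ : _ =
  \sum_(w <- poly_roots p) ((normc (w - z) < r)%R%:R : C)); last first.
  by apply: eq_bigr => w _; case: ifP.
rewrite (big_nth 0) (_ : (fun n => _) = (fun n => \sum_(0 <= i < size (poly_roots p))
   n.+1%:R^-1 * \sum_(u <- circle_points r n.+1) u / (u - ((poly_roots p)`_i - z)))); last first.
  by apply/funext => n; rewrite (big_nth 0).
rewrite big_nat_cond.
under eq_fun do rewrite big_nat_cond.
apply: cvg_sumC => i /andP[/andP[_ ip] _].
by apply: cvg_circle_average => //; apply: pr; exact: mem_nth.
Qed.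

(** The argument principle with an error term: the number of zeros in the disc is the
limit of averages of u p'/p over the N-th roots of r^N, so a pointwise bound on the
circle passes to the counts. A bound c < 1 determines an integer e exactly. *)
Lemma disc_count_diff (p1 p2 : {poly R[i]}) z r e c : 0 < r -> p1 != 0 -> p2 != 0 ->
  (forall u, normc u = r -> [/\ p1.[z + u] != 0, p2.[z + u] != 0 &
    normc (u * (p1^`().[z + u] / p1.[z + u] - p2^`().[z + u] / p2.[z + u]) - e) <= c]) ->
  normc ((disc_count (poly_roots p1) z r)%:R -
         (disc_count (poly_roots p2) z r)%:R - e) <= c.
Proof.
move=> r0 p10 p20 h.
have nor p : p != 0 -> (forall u, normc u = r -> p.[z + u] != 0) ->
    forall w, w \in poly_roots p -> normc (w - z) != r.
  move=> p0 pu w; rewrite mem_poly_roots// => pw; apply/eqP => /pu.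
  by rewrite addrC subrK -[_ == 0]/(root p w) pw.
have h1 := cvg_circle_average_logderiv r0 p10
  (nor _ p10 (fun u ur => let: And3 a _ _ := h u ur in a)).
have h2 := cvg_circle_average_logderiv r0 p20
  (nor _ p20 (fun u ur => let: And3 _ a _ := h u ur in a)).
have := cvg_subC (cvg_subC h1 h2) (cvg_cst e); set f := (X in X @ _ --> _) => /(_ _ _ _) fe.
have fc n : normc (f n) <= c.
  rewrite /f -mulrBr -sumrB.
  have n0 : n.+1%:R != 0 :> R[i] by rewrite pnatr_eq0.
  have -> : e = n.+1%:R^-1 * \sum_(u <- circle_points r n.+1) e.
    rewrite big_const_seq count_predT size_circle_points// iter_addr_0.
    by rewrite -[e *+ _]mulr_natl mulKf.
  rewrite -mulrBr -sumrB normcM normcV normc_nat ler_pdivrMl ?ltr0n//.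
  apply: le_trans (normc_sum _ _ _) _.
  have -> : n.+1%:R * c = \sum_(u <- circle_points r n.+1) c.
    rewrite big_const_seq count_predT size_circle_points// iter_addr_0.
    by rewrite mulr_natl.
  rewrite big_seq [leRHS]big_seq; apply: ler_sum => u.
  move=> /(normc_circle_points r0 (ltn0Sn _)) /h[_ _].
  by rewrite -mulrBr.
exact: (normc_lim_le fe (nearW _ fc)).
Qed.

End ArgumentPrinciple.

(** * Logarithmic derivatives of the derivatives of a polynomial *)

Section NewtonAsymptotics.
Variable F : numFieldType.
Implicit Types (us : seq F) (n : F).

(** With n = deg q and the 1/(z-w) as entries this is q^(m)(z) / (n^m q(z)); in this
normalisation Newton's identities have a limit. *)
Definition scaled_esym n us m : F := m`!%:R * esym us m / n ^+ m.

Lemma scaled_esym0 n us : scaled_esym n us 0 = 1.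
Proof.
rewrite /scaled_esym expr0 divr1 mul1r; elim: us => [|u us ih].
  by rewrite esym_nil.
by rewrite esym_cons ih mulr0 addr0.
Qed.

Lemma scaled_esymS n us m : n != 0 ->
  scaled_esym n us m.+1 =
  \sum_(i < m.+1) (-1) ^+ i * (m ^_ i)%:R * (psum us i.+1 / n) * n^-1 ^+ i *
                  scaled_esym n us (m - i).
Proof.
move=> n0; rewrite /scaled_esym factS natrM.
have -> : m.+1%:R * m`!%:R * esym us m.+1 / n ^+ m.+1 =
          m`!%:R / n ^+ m.+1 * (m.+1%:R * esym us m.+1).
  by field; rewrite expf_neq0.
rewrite newton mulr_sumr; apply: eq_bigr => -[i /= im] _.
rewrite ltnS in im; rewrite -(ffact_fact im) natrM.
rewrite -[in n ^+ m.+1](subnK im) -addnS exprD exprS exprVn.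
by field; rewrite !expf_neq0.
Qed.

Lemma scaled_esym1 n us : n != 0 -> scaled_esym n us 1 = psum us 1 / n.
Proof.
move=> n0; rewrite scaled_esymS// big_ord_recl big_ord0 subnn scaled_esym0.
by rewrite ffactn0 expr0 !mul1r !mulr1 addr0.
Qed.

(** Newton's identity without its leading term. The difference is of order 1/n, and the
factor n keeps what the second power sum contributes. *)
Lemma scaled_esym_diff n us m : n != 0 ->
  n * (scaled_esym n us m.+1 - scaled_esym n us 1 * scaled_esym n us m) =
  \sum_(i < m) (-1) ^+ i.+1 * (m ^_ i.+1)%:R * (psum us i.+2 / n) * n^-1 ^+ i *
                  scaled_esym n us (m - i.+1).
Proof.
move=> n0; rewrite scaled_esymS// big_ord_recl /= scaled_esym1//.
rewrite ffactn0 expr0 subn0 !mul1r mulr1 addrAC subrr add0r mulr_sumr.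
by apply: eq_bigr => i _; rewrite /bump /= add1n [n^-1 ^+ i.+1]exprS; field.
Qed.

End NewtonAsymptotics.

Section Limit.
Context {R : realType}.
Local Notation C := (plane R).
Variables (T : Type) (F : set_system T).
Context {FF : Filter F}.
Variables (us : T -> seq C) (n : T -> C) (l : nat -> C).
Hypothesis n0 : forall k, n k != 0.
Hypothesis ninf : (fun k => (n k)^-1) @ F --> (0 : C).
Hypothesis psum_cvg : forall i, (fun k => psum (us k) i.+1 / n k) @ F --> l i.

(** Only the term i = 0 of Newton's identity survives in the limit, giving the recursion
X_(m+1) = l_0 X_m. *)
Lemma cvg_scaled_esym m : (fun k => scaled_esym (n k) (us k) m) @ F --> (l 0 ^+ m : C).
Proof.
elim/ltn_ind: m => -[_|m ih].
  by under eq_fun do rewrite scaled_esym0; rewrite expr0; exact: cvg_cst.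
rewrite (_ : (fun k => _) = (fun k => \sum_(i < m.+1) (-1) ^+ i * (m ^_ i)%:R *
    (psum (us k) i.+1 / n k) * (n k)^-1 ^+ i * scaled_esym (n k) (us k) (m - i))); last first.
  by apply/funext => k; exact: scaled_esymS.
rewrite [X in _ --> X](_ : _ = \sum_(i < m.+1)
    (-1) ^+ i * (m ^_ i)%:R * l i * (0 : C) ^+ i * l 0 ^+ (m - i)); last first.
  rewrite big_ord_recl big1 => [|i _].
    by rewrite ffactn0 !expr0 subn0 !mul1r mulr1 addr0 exprS.
  by rewrite /= [0 ^+ _]exprS mul0r mulr0 mul0r.
apply: (cvg_sumC (FF := FF)) => i _; apply: cvg_mulC; last by apply: ih; rewrite ltnS leq_subr.
apply: cvg_mulC; last exact: cvg_expC.
by apply: cvg_mulC; [exact: cvg_cst|exact: psum_cvg].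
Qed.

(** Again a single term survives, the one of the second power sum l_1. *)
Lemma cvg_scaled_esym_diff m :
  (fun k => n k * (scaled_esym (n k) (us k) m.+1 -
                   scaled_esym (n k) (us k) 1 * scaled_esym (n k) (us k) m)) @ F
  --> (- (m%:R * l 1 * l 0 ^+ m.-1) : C).
Proof.
rewrite (_ : (fun k => _) = (fun k => \sum_(i < m) (-1) ^+ i.+1 * (m ^_ i.+1)%:R *
    (psum (us k) i.+2 / n k) * (n k)^-1 ^+ i * scaled_esym (n k) (us k) (m - i.+1))); last first.
  by apply/funext => k; exact: scaled_esym_diff.
rewrite [X in _ --> X](_ : _ = \sum_(i < m)
    (-1) ^+ i.+1 * (m ^_ i.+1)%:R * l i.+1 * (0 : C) ^+ i * l 0 ^+ (m - i.+1)); last first.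
  case: (m) => [|m']; first by rewrite big_ord0 !mul0r oppr0.
  rewrite big_ord_recl big1 => [|i _].
    by rewrite ffactn1 expr0 expr1 subn1 mulr1 addr0 !mulN1r !mulNr.
  by rewrite /= [0 ^+ _]exprS mul0r mulr0 mul0r.
apply: (cvg_sumC (FF := FF)) => i _; apply: cvg_mulC; last exact: cvg_scaled_esym.
apply: cvg_mulC; last exact: cvg_expC.
by apply: cvg_mulC; [exact: cvg_cst|exact: psum_cvg].
Qed.

End Limit.

Section DerivativeRatio.
Context {R : realType}.
Local Notation C := (plane R).
Implicit Types (q : {poly R[i]}) (z : C).

Definition inverse_dists q z : seq C := [seq (z - w)^-1 | w <- poly_roots q].

Lemma derivn_scaled_esym q z (n : C) m : n != 0 -> q.[z] != 0 ->
  q^`(m).[z] = q.[z] * n ^+ m * scaled_esym n (inverse_dists q z) m.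
Proof.
move=> n0 qz; have q0 : q != 0 by apply: contraNneq qz => ->; rewrite horner0.
rewrite {1 2}(poly_rootsE q) derivnZ !hornerZ derivn_prodXsubC; last first.
  by rewrite mem_poly_roots.
by rewrite /scaled_esym -/(inverse_dists q z); field; rewrite expf_neq0.
Qed.

(** With X_m = q^(m) / (n^m q), the difference of the logarithmic derivatives is
n (X_(m+1) - X_1 X_m) / X_m, whose numerator and denominator tend to
- m l_1 l_0^(m-1) and l_0^m. The point z_k may depend on k: this gives uniformity on
circles. *)
Lemma cvg_logderiv_derivn (T : Type) (F : set_system T) {FF : Filter F}
    (q : T -> {poly R[i]}) (z n : T -> C) (l : nat -> C) m :
  (forall k, n k != 0) -> (fun k => (n k)^-1) @ F --> (0 : C) ->
  (\forall k \near F, (q k).[z k] != 0) ->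
  (forall i, (fun k => psum (inverse_dists (q k) (z k)) i.+1 / n k) @ F --> l i) ->
  l 0 != 0 ->
  (\forall k \near F, (q k)^`(m).[z k] != 0) /\
  (fun k => (q k)^`(m)^`().[z k] / (q k)^`(m).[z k] -
            (q k)^`().[z k] / (q k).[z k]) @ F --> (- (m%:R * l 1 / l 0) : C).
Proof.
move=> n0 ninf qz pl l0.
have X_cvg : (fun k => scaled_esym (n k) (inverse_dists (q k) (z k)) m) @ F -->
    (l 0 ^+ m : C) by exact: cvg_scaled_esym.
have X0 : \forall k \near F, scaled_esym (n k) (inverse_dists (q k) (z k)) m != 0.
  have lm0 : 0 < normc (l 0 ^+ m) by rewrite normc_gt0 expf_neq0.
  move/cvg_normcP: X_cvg => /(_ _ lm0); apply: filterS => k.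
  by apply: contraTneq => ->; rewrite subr0 ltxx.
have qm0 : \forall k \near F, (q k)^`(m).[z k] != 0.
  near=> k; have qk : (q k).[z k] != 0 by near: k.
  have Xk : scaled_esym (n k) (inverse_dists (q k) (z k)) m != 0 by near: k.
  by rewrite (derivn_scaled_esym m (n0 k) qk) mulf_neq0// mulf_neq0// expf_neq0.
split; first exact: qm0.
have D_cvg := cvg_scaled_esym_diff (FF := FF) n0 ninf pl (m := m).
have := cvg_mulC (FF := FF) D_cvg (cvg_invC (FF := FF) (expf_neq0 m l0) X_cvg).
have -> : - (m%:R * l 1 * l 0 ^+ m.-1) / l 0 ^+ m = - (m%:R * l 1 / l 0).
  case: (m) => [|m']; first by rewrite !mul0r oppr0 mul0r.
  by rewrite exprS /=; field; rewrite l0 expf_neq0.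
apply: cvg_trans; apply: near_eq_cvg.
near=> k; have qk : (q k).[z k] != 0 by near: k.
have Xk : scaled_esym (n k) (inverse_dists (q k) (z k)) m != 0 by near: k.
rewrite -derivnS -[(q k)^`() in RHS]derivn1.
rewrite !(derivn_scaled_esym _ (n0 k) qk) exprS expr1.
by field; rewrite ?Xk ?qk ?expf_neq0 ?n0.
Unshelve. all: by end_near. Qed.

End DerivativeRatio.

(** * Ultrafilter limits and clusters of points *)

Section Near.
Variables (T : Type) (F : set_system T).
Implicit Types P Q : T -> Prop.

Lemma near_and {FF : Filter F} P Q : (\forall k \near F, P k) ->
  (\forall k \near F, Q k) -> \forall k \near F, P k /\ Q k.
Proof. by move=> FP FQ; near=> k; split; near: k. Unshelve. all: by end_near. Qed.

Lemma near_imp {FF : Filter F} P Q : (forall k, P k -> Q k) ->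
  (\forall k \near F, P k) -> \forall k \near F, Q k.
Proof. by move=> PQ FP; near=> k; apply: PQ; near: k. Unshelve. all: by end_near. Qed.

Lemma near_ex {FF : ProperFilter F} P : (\forall k \near F, P k) -> exists k, P k.
Proof. exact: filter_ex. Qed.

Lemma ultra_nearN {FU : UltraFilter F} P :
  ~ (\forall k \near F, P k) -> \forall k \near F, ~ P k.
Proof. by move=> nP; have [//|] := in_ultra_setVsetC [set k | P k] FU. Qed.

End Near.

Section UltraLimits.
Context {R : realType}.
Local Notation C := (plane R).

(** If f stayed away from l on a set whose complement is not in F, it would do so along
an ultrafilter containing F and that set. *)
Lemma cvg_ultra (T : Type) (F : set_system T) {FF : ProperFilter F} (f : T -> C) (l : C) :
  (forall G, UltraFilter G -> F `<=` G -> f @ G --> l) -> f @ F --> l.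
Proof.
move=> h; apply/cvg_normcP => e e0; apply: contrapT => nF.
pose A := [set k | ~ normc (l - f k) < e].
have wF : ProperFilter (within A F).
  apply: Build_ProperFilter_ex => P wP; apply: contrapT => nP; apply: nF.
  apply: (near_imp (F := F) _ wP) => k kP; apply: contrapT => nk; apply: nP.
  by exists k; exact: kP.
have [G [GU wG]] := ultraFilterLemma wF.
have FG : F `<=` G by move=> P FP; apply: wG; exact: (near_imp (F := F) (fun k Pk _ => Pk) FP).
have /cvg_normcP/(_ _ e0) := h G GU FG.
have GA : \forall k \near G, A k by apply: wG; apply: withinT.
by move=> /(near_and GA)/near_ex[k [nk /nk]].
Qed.

End UltraLimits.

Section Clusters.
Context {R : realType}.
Local Notation C := (plane R).
Implicit Types (z w : C) (r : R) (s : seq C).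

Lemma near_seq (T : Type) (I : eqType) (F : set_system T) {FF : Filter F}
    (zs : seq I) (P : I -> T -> Prop) :
  (forall i, i \in zs -> \forall k \near F, P i k) ->
  \forall k \near F, forall i, i \in zs -> P i k.
Proof.
elim: zs => [_|a zs ih h]; first by near=> k.
have ha : \forall k \near F, P a k by apply: h; rewrite inE eqxx.
have {}ih : \forall k \near F, forall i, i \in zs -> P i k.
  by apply: ih => z zzs; apply: h; rewrite inE zzs orbT.
near=> k => z; rewrite inE => /orP[/eqP ->|]; first by near: k.
by move: z; near: k.
Unshelve. all: by end_near. Qed.

Lemma disc_count_le s z r z' r' : (forall w, normc (w - z) < r -> normc (w - z') < r') ->
  (disc_count s z r <= disc_count s z' r')%N.
Proof. by move=> h; apply: sub_count => w; exact: h. Qed.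

Lemma disc_count_disjoint s z r0 z' r r' :
  normc (z' - z) + r' <= r0 -> r + r' <= normc (z' - z) -> 0 < r' ->
  (disc_count s z r + disc_count s z' r' <= disc_count s z r0)%N.
Proof.
move=> h1 h2 r'0; rewrite /disc_count -count_predUI.
rewrite [X in (_ + X)%N](_ : _ = 0%N) ?addn0; last first.
  rewrite (eq_count (a2 := pred0)) ?count_pred0// => w /=.
  apply/negbTE/negP => /andP[wz wz'].
  by have := normc_dist_le z' z w; rewrite (normcB z' w); lra.
apply: sub_count => w /= /orP[wz|wz'].
  by apply: (lt_le_trans wz); have := normc_ge0 (z' - z); lra.
by have := normc_dist_le w z z'; lra.
Qed.

Section Filter.
Variables (T : Type) (F : set_system T) (s : T -> seq C).

(** Along F exactly c of the points tend to z, and the others are outside of the disc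
of radius r0. *)
Definition cluster_radius z c r0 := 0 < r0 /\ forall r, 0 < r -> r <= r0 ->
  \forall k \near F, disc_count (s k) z r = c.

Definition cluster_count z c := exists r0, cluster_radius z c r0.

(** Take for c the least number that eventually bounds the count in some disc around z.
In a smaller disc the count is at most c, and along an ultrafilter it is eventually
c or eventually less; the second case would contradict minimality. *)
Lemma cluster_count_ex z r0 M : UltraFilter F -> 0 < r0 ->
  (\forall k \near F, (disc_count (s k) z r0 <= M)%N) ->
  exists2 c, (c <= M)%N & exists2 r, r <= r0 & cluster_radius z c r.
Proof.
move=> FU r00 hM.
(* The eventual bounds in discs of radius at most r0. *)
pose P c := `[< exists2 r, 0 < r <= r0 &
  \forall k \near F, (disc_count (s k) z r <= c)%N >].
have exP : exists c, P c by exists M; apply/asboolP; exists r0; rewrite ?r00/=.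
have [c /asboolP[r /andP[r_gt0 rr0] hr] cmin] := ex_minnP exP.
exists c.
  by apply: cmin; apply/asboolP; exists r0; rewrite ?r00/=.
exists r => //; split => // r1 r10 r1r.
apply: contrapT => /ultra_nearN hn.
have [k [h1 /eqP h2]] := near_ex (near_and hr hn).
have le1 k' : (disc_count (s k') z r1 <= disc_count (s k') z r)%N.
  by apply: disc_count_le => w /lt_le_trans; apply.
case: (posnP c) => [c0|c0].
  by case/negP: h2; rewrite c0 -leqn0 -c0 (leq_trans (le1 _)).
have : P c.-1.
  apply/asboolP; exists r1; first by rewrite r10 (le_trans r1r).
  apply: near_imp (near_and hr hn) => {h1 h2}k [h1 /eqP h2].
  by rewrite -ltnS prednK// ltn_neqAle h2 (leq_trans (le1 _)).
by move=> /cmin; rewrite leqNgt prednK// leqnn.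
Qed.

Context {FF : ProperFilter F}.

(** The disc of radius r0 contains as many points as any smaller disc around z, which
leaves none for a disc around z'. *)
Lemma cluster_count_isolated z c r0 z' c' : cluster_radius z c r0 ->
  normc (z' - z) < r0 -> z' != z -> cluster_count z' c' -> c' = 0%N.
Proof.
move=> [r00 h] zr z'z [r1 [r10 h1]].
have d0 : 0 < normc (z' - z) by rewrite normc_gt0 subr_eq0.
pose d := normc (z' - z).
(* The discs of radius r2 around z and z' are disjoint and lie in that of radius r0. *)
pose r2 := Num.min r1 (Num.min ((r0 - d) / 2) (d / 2)).
have r20 : 0 < r2 by rewrite !lt_min r10/= !divr_gt0// subr_gt0.
have r2r1 : r2 <= r1 by rewrite /r2 ge_min lexx.
have r2r0 : r2 <= (r0 - d) / 2 by rewrite /r2 !ge_min lexx orbT.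
have r2d : r2 <= d / 2 by rewrite /r2 !ge_min lexx !orbT.
have dE : normc (z' - z) = d by [].
have r2lr0 : r2 <= r0 by lra.
have [k [[e1 e2] e3]] := near_ex
  (near_and (near_and (h1 _ r20 r2r1) (h _ r00 (lexx _))) (h _ r20 r2lr0)).
have : (disc_count (s k) z r2 + disc_count (s k) z' r2 <=
        disc_count (s k) z r0)%N by apply: disc_count_disjoint; lra.
by rewrite e1 e2 e3 -{2}(addn0 c) leq_add2l leqn0 => /eqP.
Qed.

Lemma cluster_cover (U K : set C) (c : C -> nat) : compact K -> K `<=` U ->
  (forall z, U z -> cluster_count z (c z)) ->
  exists zs : seq C, exists rho : C -> R,
    [/\ uniq zs, forall z, z \in zs -> K z,
        forall z, z \in zs -> cluster_radius z (c z) (rho z) &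
        forall w, K w -> exists2 z, z \in zs & normc (w - z) < rho z].
Proof.
move=> + KU cU; rewrite compact_cover => cK.
have /choice[rho rhoP] : forall z, exists r, K z -> cluster_radius z (c z) r.
  move=> z; have [/KU/cU [r ?]|?] := pselect (K z); first by exists r.
  by exists 0.
have [|w Kw|D DK KD] := cK C K (fun z => disc z (rho z)).
- by move=> z Kz; exact: open_disc.
- exists w => //; rewrite /disc/= subrr normc0.
  by case: (rhoP _ Kw).
exists (finmap.enum_fset D), rho; split => //.
- exact: finmap.fset_uniq.
- move=> z zD; have := DK z; rewrite inE; exact.
- by move=> z zD; apply: rhoP; have := DK z; rewrite inE; exact.
Qed.

End Filter.

Lemma count_lt (I : eqType) (t : seq I) (a b : pred I) (i : I) :
  (forall j, a j -> b j) -> i \in t -> b i -> ~ a i -> (count a t < count b t)%N.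
Proof.
move=> ab it bi ai; have -> : count a t = count a [seq j <- t | b j].
  by rewrite count_filter; apply: eq_count => j /=; case: (boolP (a j)) => // /ab ->.
rewrite -(size_filter b t) ltn_neqAle count_size andbT -all_count.
by apply/allPn; exists i; [rewrite mem_filter bi|apply/negP].
Qed.

Lemma fsbig_uniq_seq (U : set C) (zs : seq C) (f : C -> C) : uniq zs ->
  (forall z, z \in zs -> U z) -> (forall z, U z -> z \notin zs -> f z = 0) ->
  \sum_(z \in U) f z = \sum_(z <- zs) f z.
Proof.
move=> uzs zsU f0; rewrite [RHS]fsbig_seq//; symmetry; apply: fsbig_widen; first exact: zsU.
by move=> z [Uz /= /negP zzs]; exact: f0.
Qed.

(** The discs around the points of zs are disjoint and contain all points where phi
does not vanish. *)
Lemma sum_disc_partition (phi : C -> C) s (zs : seq C) r :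
  uniq zs ->
  {in zs &, forall z z', z != z' -> 2 * r <= normc (z - z')} ->
  (forall w, w \in s -> phi w != 0 -> exists2 z, z \in zs & normc (w - z) < r) ->
  \sum_(w <- s) phi w = \sum_(z <- zs) \sum_(w <- s | normc (w - z) < r) phi w.
Proof.
move=> uzs sep cov.
have -> : \sum_(z <- zs) \sum_(w <- s | normc (w - z) < r) phi w =
  \sum_(w <- s) \sum_(z <- zs | normc (w - z) < r) phi w.
  by rewrite (exchange_big_dep xpredT).
apply: eq_big_seq => w ws.
have [->|pw] := eqVneq (phi w) 0; first by rewrite big1.
have [z zzs wz] := cov w ws pw.
rewrite big_mkcond (bigD1_seq z)//= wz big1_seq ?addr0// => z' /andP[z'z z'zs].
case: ifPn => // wz'; exfalso; have := sep _ _ z'zs zzs z'z.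
by have := normc_dist_le z' z w; rewrite (normcB z' w); lra.
Qed.

(** By compactness the support of phi is covered by finitely many discs, each of which
contains the cluster at its centre and no other points of s k. In radius r the
points of the cluster at z differ from z by less than r, and phi is continuous. *)
Lemma cvg_cluster_sum (T : Type) (F : set_system T) {FF : ProperFilter F}
    (s : T -> seq C) (U : set C) (c : C -> nat) (phi : C -> C) :
  (forall z, U z -> cluster_count F s z (c z)) ->
  compactly_supported_in U phi ->
  (fun k => \sum_(w <- s k) phi w) @ F --> (\sum_(z \in U) (c z)%:R * phi z : C).
Proof.
move=> cU [cphi Kc KU].
have supp z : phi z != 0 -> closure [set z | phi z != 0] z.
  by move=> pz; apply: (@subset_closure _ [set z | phi z != 0]).
have [zs [rho [uzs zsK zsrho cov]]] := cluster_cover Kc KU cU.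
have -> : \sum_(z \in U) (c z)%:R * phi z = \sum_(z <- zs) (c z)%:R * phi z.
  apply: fsbig_uniq_seq => // [z /zsK/KU//|z Uz zzs].
  have [->|pz] := eqVneq (phi z) 0; first by rewrite mulr0.
  have [z1 z1zs zz1] := cov z (supp _ pz).
  rewrite (cluster_count_isolated (zsrho _ z1zs) zz1 _ (cU _ Uz)) ?mul0r//.
  by apply: contraNneq zzs => ->.
apply/cvg_normcP => e e0.
(* M bounds the total number of points in the clusters; the 1 keeps it positive. *)
pose M : R := (\sum_(z <- zs) c z)%:R + 1.
have M0 : 0 < M by rewrite ltr_wpDl.
pose good z (r : R) := [/\ r <= rho z,
  forall w, normc (w - z) < r -> normc (phi w - phi z) <= e / M &
  forall z', z' \in zs -> z != z' -> 2 * r <= normc (z - z')].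
have [r [r0 rgood]] : exists r : R, 0 < r /\ forall z, z \in zs -> good z r.
  apply: (@near_ex _ (at_right (0 : R))).
  apply: near_and; first exact: nbhs_right_gt.
  apply: near_seq => z zzs.
  have [rho0 _] := zsrho z zzs.
  have [d d0 dphi] : exists2 d, 0 < d & forall w, normc (w - z) < d ->
      normc (phi w - phi z) <= e / M.
    have /(cvg_normcP (FF := nbhs_filter z)) := cphi z.
    move=> /(_ _ (divr_gt0 e0 M0)) /nbhs_discP[d d0 dphi].
    by exists d => // w /dphi /=; rewrite normcB => /ltW.
  have h1 : \forall r \near at_right (0 : R), r <= rho z by exact: nbhs_right_le.
  have h2 : \forall r \near at_right (0 : R), r <= d by exact: nbhs_right_le.
  have h3 : \forall r \near at_right (0 : R), forall z', z' \in zs ->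
      z != z' -> r <= normc (z - z') / 2.
    apply: near_seq => z' _; have [->|zz'] := eqVneq z z'; first by near=> r.
    have zz'0 : 0 < normc (z - z') / 2 by rewrite divr_gt0// normc_gt0 subr_eq0.
    apply: near_imp (nbhs_right_le zz'0) => r rz _; exact: rz.
  apply: near_imp (near_and (near_and h1 h2) h3) => r [[r1 r2] r3]; split => //.
    by move=> w wz; apply: dphi; exact: lt_le_trans r2.
  by move=> z' /r3 h /h; lra.
have hk : \forall k \near F, forall z, z \in zs ->
    disc_count (s k) z (rho z) = c z /\ disc_count (s k) z r = c z.
  apply: near_seq => z zzs; have [rho0 hrho] := zsrho z zzs.
  have [rrho _ _] := rgood z zzs.
  by apply: near_and; apply: hrho.
apply: near_imp hk => k hk.
rewrite (@sum_disc_partition phi (s k) zs r)//; first last.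
- move=> w ws pw; have [z zzs wz] := cov w (supp _ pw).
  exists z => //; have [hz1 hz2] := hk z zzs; have [rrho _ _] := rgood z zzs.
  apply: contrapT => wr.
  have : (disc_count (s k) z r < disc_count (s k) z (rho z))%N.
    by apply: (count_lt _ ws wz wr) => u /lt_le_trans; apply.
  by rewrite hz1 hz2 ltnn.
- by move=> z z' zzs z'zs zz'; have [_ _ h] := rgood z zzs; exact: h.
rewrite -sumrB; apply: le_lt_trans (normc_sum _ _ _) _.
have le1 : \sum_(z <- zs) normc ((c z)%:R * phi z -
    \sum_(w <- s k | normc (w - z) < r) phi w) <=
    \sum_(z <- zs) (c z)%:R * (e / M).
  rewrite big_seq [leRHS]big_seq; apply: ler_sum => z zzs.
  have [_ <-] := hk z zzs; have [_ phir _] := rgood z zzs.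
  rewrite /disc_count -sum1_count natr_sum mulr_suml -sumrB.
  rewrite natr_sum mulr_suml; apply: le_trans (normc_sum _ _ _) _.
  by apply: ler_sum => w wz; rewrite !mul1r normcB; exact: phir.
apply: le_lt_trans le1 _; rewrite -mulr_suml -natr_sum mulrCA gtr_pMr//.
by rewrite ltr_pdivrMr// mul1r ltrDl.
Unshelve. all: by end_near. Qed.

End Clusters.

(** * Averages over the distant roots *)

Section OuterMean.
Context {R : realType}.
Local Notation C := (plane R).
Variables (T : Type) (F : set_system T) (s : T -> seq C) (z0 : C) (r0 : R).
Context {FU : UltraFilter F}.
Hypothesis r0_gt0 : 0 < r0.
Implicit Types (f g : C -> C) (z w h : C) (a b : C) (B : R).

(** The inequality is not strict, so that 1/(w - z0) is bounded on these points. *)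
Definition outside w := r0 <= normc (w - z0).

(** The sum runs over the distant points while the division is by the number of all
points: this is integration against the root distribution restricted to the
complement of the disc. *)
Definition outer_mean f (k : T) : C :=
  (size (s k))%:R^-1 * \sum_(w <- s k | outside w) f w.

Definition outer_lim f : C := lim (outer_mean f @ F).

Definition outer_bounded f B := forall w, outside w -> normc (f w) <= B.

Lemma outer_mean_le f B k : 0 <= B -> outer_bounded f B -> normc (outer_mean f k) <= B.
Proof.
move=> B0 fB; rewrite /outer_mean; have [s0|s0] := posnP (size (s k)).
  by rewrite s0 invr0 mul0r normc0.
rewrite normcM normcV normc_nat ler_pdivrMl ?ltr0n//.
apply: le_trans (normc_sum _ _ _) _.
have -> : (size (s k))%:R * B = \sum_(w <- s k) B.
  by rewrite big_const_seq count_predT iter_addr_0 mulr_natl.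
rewrite big_mkcond; apply: ler_sum => w _; case: ifP => // wo; exact: fB.
Qed.

Lemma outer_bounded_ge0 f B : outer_bounded f B -> outer_bounded f `|B|.
Proof. by move=> fB w /fB /le_trans; apply; exact: ler_norm. Qed.

Lemma cvg_outer_mean f B : outer_bounded f B -> outer_mean f @ F --> outer_lim f.
Proof.
move=> /outer_bounded_ge0 fB.
have [|l _ fl] := @ultra_cvg_bounded _ _ F (outer_mean f) `|B| FU.
  by near=> k; exact: outer_mean_le.
by rewrite /outer_lim; apply/cvg_ex; exists l.
Unshelve. all: by end_near. Qed.

Lemma outer_limE f l : outer_mean f @ F --> l -> outer_lim f = l.
Proof. by move=> fl; apply: (cvg_lim (@norm_hausdorff _ C)). Qed.

Lemma outer_lim_le f B : 0 <= B -> outer_bounded f B -> normc (outer_lim f) <= B.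
Proof.
move=> B0 fB; apply: (normc_lim_le (cvg_outer_mean fB)).
by near=> k; exact: outer_mean_le.
Unshelve. all: by end_near. Qed.

Lemma eq_outer_lim f g : (forall w, outside w -> f w = g w) -> outer_lim f = outer_lim g.
Proof.
move=> fg; rewrite /outer_lim; congr (lim (_ @ F)); apply/funext => k.
by rewrite /outer_mean; congr (_ * _); apply: eq_bigr => w; exact: fg.
Qed.

Lemma outer_limD f g B B' : outer_bounded f B -> outer_bounded g B' ->
  outer_lim (fun w => f w + g w) = outer_lim f + outer_lim g.
Proof.
move=> fB gB; apply: outer_limE.
rewrite (_ : outer_mean _ = fun k => outer_mean f k + outer_mean g k).
  exact: (cvg_addC (cvg_outer_mean fB) (cvg_outer_mean gB)).
by apply/funext => k; rewrite /outer_mean big_split mulrDr.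
Qed.

Lemma outer_limZ f B a : outer_bounded f B ->
  outer_lim (fun w => a * f w) = a * outer_lim f.
Proof.
move=> fB; apply: outer_limE.
rewrite (_ : outer_mean _ = fun k => a * outer_mean f k).
  exact: (cvg_mulC (cvg_cst a) (cvg_outer_mean fB)).
by apply/funext => k; rewrite /outer_mean -mulr_sumr mulrCA.
Qed.

Lemma outer_boundedZ f B a : outer_bounded f B ->
  outer_bounded (fun w => a * f w) (normc a * B).
Proof. by move=> fB w wo; rewrite normcM ler_wpM2l ?normc_ge0 ?fB. Qed.

Lemma outer_boundedB f g B B' : outer_bounded f B -> outer_bounded g B' ->
  outer_bounded (fun w => f w - g w) (B + B').
Proof.
move=> fB gB w wo; apply: le_trans (normcD _ _) _.
by rewrite normcN lerD ?fB ?gB.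
Qed.

Lemma outer_boundedM f g B B' : 0 <= B -> outer_bounded f B -> outer_bounded g B' ->
  outer_bounded (fun w => f w * g w) (B * B').
Proof.
by move=> B0 fB gB w wo; rewrite normcM ler_pM ?normc_ge0 ?fB ?gB.
Qed.

Lemma outer_limB f g B B' : outer_bounded f B -> outer_bounded g B' ->
  outer_lim (fun w => f w - g w) = outer_lim f - outer_lim g.
Proof.
move=> fB gB; rewrite -[- outer_lim g]mulN1r -(outer_limZ _ gB).
rewrite -(outer_limD fB (outer_boundedZ (-1) gB)).
by apply: eq_outer_lim => w _; rewrite mulN1r.
Qed.

Lemma Re_outer_lim f B : outer_bounded f B ->
  outer_lim (fun w => (complex.Re (f w))%:C) = (complex.Re (outer_lim f))%:C.
Proof.
move=> fB; apply: outer_limE.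
have h : (fun k => complex.Re (outer_mean f k)) @ F --> complex.Re (outer_lim f).
  apply: (cvg_comp _ _ (cvg_outer_mean fB)); exact: continuous_Re.
have := cvg_comp _ _ h (@continuous_real_complex R _).
apply: cvg_trans; apply: near_eq_cvg; near=> k; rewrite /= /outer_mean.
have ReM (x : R) (a : C) : complex.Re (x%:C * a) = x * complex.Re a.
  by case: a => ? ?; rewrite /= mul0r subr0.
have ReD : {morph (fun a : C => (complex.Re a)%:C) : a b / a + b}.
  by move=> [? ?] [? ?]; rewrite -rmorphD.
have -> : (size (s k))%:R^-1 = ((size (s k))%:R^-1)%:C :> C.
  by rewrite fmorphV rmorph_nat.
rewrite ReM rmorphM /=; congr (_ * _).
exact: (big_morph (fun a : C => (complex.Re a)%:C : C) ReD (erefl _)).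
Unshelve. all: by end_near. Qed.

(** [cauchy 0] is the Cauchy transform of the distant points; [cauchy e] is its quotient
by (z - z0)^e when the moments below e vanish. *)
Definition cauchy e z := outer_lim (fun w => (w - z0)^-1 ^+ e * (z - w)^-1).
(** The complex derivative of [cauchy e]. *)
Definition cauchy' e z := outer_lim (fun w => - ((w - z0)^-1 ^+ e * (z - w)^-1 ^+ 2)).
(** Up to the sign, the Taylor coefficients of [cauchy 0] at z0. *)
Definition moment e := outer_lim (fun w => (w - z0)^-1 ^+ e.+1).

Lemma outside_neq0 w : outside w -> w - z0 != 0.
Proof. by move=> wo; rewrite -normc_gt0 (lt_le_trans r0_gt0). Qed.

Lemma outside_dist z w : outside w -> r0 - normc (z - z0) <= normc (z - w).
Proof.
rewrite /outside => wo; have := normc_dist_le w z0 z.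
by rewrite (normcB w z); lra.
Qed.

Lemma outside_dist_neq0 z w : normc (z - z0) < r0 -> outside w -> z - w != 0.
Proof.
move=> zr wo; rewrite -normc_gt0; apply: lt_le_trans (outside_dist _ wo).
by rewrite subr_gt0.
Qed.

Lemma bounded_kernel z : normc (z - z0) < r0 ->
  outer_bounded (fun w => (z - w)^-1) (r0 - normc (z - z0))^-1.
Proof.
move=> zr w wo; rewrite normcV lef_pV2 ?posrE ?subr_gt0//.
  exact: outside_dist.
by rewrite normc_gt0 outside_dist_neq0.
Qed.

Lemma outer_boundedX f B e : 0 <= B -> outer_bounded f B ->
  outer_bounded (fun w => f w ^+ e) (B ^+ e).
Proof. by move=> B0 fB w wo; rewrite normcX lerXn2r ?nnegrE ?normc_ge0 ?fB. Qed.

Lemma bounded_moment e : outer_bounded (fun w => (w - z0)^-1 ^+ e) (r0^-1 ^+ e).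
Proof.
apply: outer_boundedX => [|w wo]; first by rewrite invr_ge0 ltW.
by rewrite normcV lef_pV2 ?posrE// normc_gt0 outside_neq0.
Qed.

Lemma kernel_gap_ge0 z : normc (z - z0) < r0 -> 0 <= (r0 - normc (z - z0))^-1.
Proof. by move=> zr; rewrite invr_ge0 subr_ge0 ltW. Qed.

Lemma moment_bound_ge0 e : 0 <= r0^-1 ^+ e.
Proof. by rewrite exprn_ge0// invr_ge0 ltW. Qed.

Lemma bounded_cauchy e z : normc (z - z0) < r0 ->
  outer_bounded (fun w => (w - z0)^-1 ^+ e * (z - w)^-1)
    (r0^-1 ^+ e * (r0 - normc (z - z0))^-1).
Proof.
move=> zr; apply: outer_boundedM; first exact: moment_bound_ge0.
  exact: bounded_moment.
exact: bounded_kernel.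
Qed.

Lemma bounded_cauchy' e z : normc (z - z0) < r0 ->
  outer_bounded (fun w => - ((w - z0)^-1 ^+ e * (z - w)^-1 ^+ 2))
    (r0^-1 ^+ e * (r0 - normc (z - z0))^-1 ^+ 2).
Proof.
move=> zr w wo; rewrite normcN; move: w wo.
apply: outer_boundedM; first exact: moment_bound_ge0.
  exact: bounded_moment.
by apply: outer_boundedX; [exact: kernel_gap_ge0|exact: bounded_kernel].
Qed.

(** The integrated form of 1/((w-z0)^e (z-w)) = (z-z0)/((w-z0)^(e+1) (z-w)) - 1/(w-z0)^(e+1). *)
Lemma cauchyS e z : normc (z - z0) < r0 ->
  cauchy e z = (z - z0) * cauchy e.+1 z - moment e.
Proof.
move=> zr; rewrite /cauchy /moment -(outer_limZ _ (bounded_cauchy e.+1 zr)).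
rewrite -(outer_limB (outer_boundedZ _ (bounded_cauchy e.+1 zr)) (bounded_moment e.+1)).
apply: eq_outer_lim => w wo; rewrite [_ ^+ e.+1]exprS exprVn.
have w0 := outside_neq0 wo; have zw := outside_dist_neq0 zr wo.
by field; rewrite zw w0 expf_neq0.
Qed.

(** The derivative of the preceding recursion. *)
Lemma cauchy'S e z : normc (z - z0) < r0 ->
  cauchy' e z = cauchy e.+1 z + (z - z0) * cauchy' e.+1 z.
Proof.
move=> zr; rewrite /cauchy' /cauchy -(outer_limZ _ (bounded_cauchy' e.+1 zr)).
rewrite -(outer_limD (bounded_cauchy e.+1 zr) (outer_boundedZ _ (bounded_cauchy' e.+1 zr))).
apply: eq_outer_lim => w wo; rewrite [_ ^+ e.+1]exprS expr2 exprVn.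
have w0 := outside_neq0 wo; have zw := outside_dist_neq0 zr wo.
by field; rewrite zw w0 expf_neq0.
Qed.

Lemma cauchy_factor e z : normc (z - z0) < r0 ->
  (forall j, (j < e)%N -> moment j = 0) ->
  cauchy 0 z = (z - z0) ^+ e * cauchy e z /\
  (z - z0) * cauchy' 0 z =
    (z - z0) ^+ e * (e%:R * cauchy e z + (z - z0) * cauchy' e z).
Proof.
move=> zr; elim: e => [|e ih] m0; first by rewrite !expr0 !mul1r mul0r add0r.
have [|-> ->] := ih; first by move=> j je; apply: m0; exact: ltnW.
have := cauchyS e zr; rewrite m0// subr0 => ->; have -> := cauchy'S e zr.
by rewrite !exprS -[e.+1%:R]natr1; split; ring.
Qed.

Lemma cauchy_center e : cauchy e z0 = - moment e.
Proof. by rewrite cauchyS subrr ?mul0r ?add0r// normc0. Qed.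

(** If all moments vanish, [cauchy 0 z] = (z-z0)^e [cauchy e z] for every e, and this is
of the order of (|z-z0|/r0)^e. *)
Lemma cauchy0_eq0 z : normc (z - z0) < r0 -> (forall j, moment j = 0) -> cauchy 0 z = 0.
Proof.
move=> zr m0; apply/eqP; rewrite -normc_eq0; apply/eqP/le_anti.
rewrite normc_ge0 andbT; set q := normc (z - z0) / r0.
have qn : normc q%:C < 1.
  rewrite normc_real ger0_norm ?ltr_pdivrMr ?mul1r//.
  by rewrite divr_ge0 ?normc_ge0 ?ltW.
rewrite leNgt; apply/negP => x0; have K0 : 0 < r0 - normc (z - z0) by rewrite subr_gt0.
have /cvg_normcP/(_ _ (mulr_gt0 x0 K0)) := cvg_geometricC qn.
move=> /near_ex[e]; rewrite sub0r normcN normcX normc_real ger0_norm; last first.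
  by rewrite divr_ge0 ?normc_ge0 ?ltW.
rewrite -ltr_pdivrMr// ltNge => /negP; apply.
have [-> _] := cauchy_factor zr (fun j (_ : (j < e.+1)%N) => m0 j).
rewrite normcM normcX /q expr_div_n -exprVn -mulrA.
rewrite ler_wpM2l ?exprn_ge0 ?normc_ge0//.
apply: outer_lim_le (bounded_cauchy _ zr).
by rewrite mulr_ge0 ?moment_bound_ge0 ?kernel_gap_ge0.
Qed.

(** The kernel satisfies 1/(z+h-w) - 1/(z-w) + h/(z-w)^2 = h^2/((z-w)^2 (z+h-w)), and
|z+h-w| is at least half of r0 - |z-z0|. *)
Lemma cauchy_quadratic e z h : normc (z - z0) < r0 ->
  normc h <= (r0 - normc (z - z0)) / 2 ->
  normc (cauchy e (z + h) - cauchy e z - h * cauchy' e z) <=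
  2 * r0^-1 ^+ e * (r0 - normc (z - z0))^-1 ^+ 3 * normc h ^+ 2.
Proof.
move=> zr hr; set d := r0 - normc (z - z0).
have d0 : 0 < d by rewrite subr_gt0.
have zhr : normc (z + h - z0) <= r0 - d / 2.
  by have := normcD (z - z0) h; rewrite addrAC /d; lra.
have zhr' : normc (z + h - z0) < r0 by lra.
rewrite /cauchy /cauchy' -(outer_limZ _ (bounded_cauchy' e zr)).
rewrite -(outer_limB (bounded_cauchy e zhr') (bounded_cauchy e zr)).
rewrite -(outer_limB (outer_boundedB (bounded_cauchy e zhr') (bounded_cauchy e zr))
                     (outer_boundedZ h (bounded_cauchy' e zr))).
have d10 : 0 <= d^-1 by rewrite invr_ge0 ltW.
apply: outer_lim_le => [|w wo].
  rewrite mulr_ge0 ?exprn_ge0 ?normc_ge0// mulr_ge0 ?exprn_ge0//.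
  by rewrite mulr_ge0 ?moment_bound_ge0.
have w0 := outside_neq0 wo; have zw := outside_dist_neq0 zr wo.
have zhw := outside_dist_neq0 zhr' wo.
rewrite (_ : _ - _ = (w - z0)^-1 ^+ e * ((z - w)^-1 ^+ 2 * (z + h - w)^-1) * h ^+ 2); last first.
  by rewrite !exprVn; field; rewrite zhw zw expf_neq0.
rewrite [leLHS]normcM normcX ler_wpM2r ?exprn_ge0 ?normc_ge0//.
have -> : 2 * r0^-1 ^+ e * d^-1 ^+ 3 = r0^-1 ^+ e * (d^-1 ^+ 2 * (d / 2)^-1).
  by rewrite invfM invrK; ring.
rewrite normcM ler_pM ?normc_ge0//; first exact: (bounded_moment e wo).
rewrite normcM normcX ler_pM ?normc_ge0 ?exprn_ge0 ?normc_ge0//.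
  by rewrite lerXn2r ?nnegrE ?normc_ge0//; exact: (bounded_kernel zr wo).
apply: le_trans (bounded_kernel zhr' wo) _.
by rewrite lef_pV2 ?posrE; lra.
Qed.

End OuterMean.

(** * Potentials with a logarithmic kernel *)

Section QuadraticRemainder.

(** All the derivatives that occur below, real or complex, come from a quadratic bound
on the remainder. *)
Lemma quadratic_is_derive (K : numFieldType) (f : K^o -> K^o) (z d M e : K) :
  0 <= M -> 0 < e ->
  (forall h, `|h| < e -> `|f (z + h) - f z - h * d| <= M * `|h| ^+ 2) ->
  is_derive (z : K^o) (1 : K^o) f (d : K^o).
Proof.
move=> M0 e0 hf.
have M1 : 0 < M + 1 by rewrite ltr_wpDl.
have lim_f : (fun h : K => h^-1 *: (f (h *: (1 : K^o) + z) - f z) : K^o) @ 0^' -->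
    (d : K^o).
  apply/cvgrPdist_lt => eps eps0; near=> h.
  have h0 : h != 0 by near: h; exact: nbhs_dnbhs_neq.
  have he : `|h| < e by near: h; exact: dnbhs0_lt.
  have heps : `|h| < eps / (M + 1) by near: h; apply: dnbhs0_lt; rewrite divr_gt0.
  have -> : d - h^-1 *: (f (h *: (1 : K^o) + z) - f z) =
            - (h^-1 * (f (z + h) - f z - h * d)).
    have -> : h *: (1 : K^o) + z = z + h by rewrite /GRing.scale /= mulr1 addrC.
    rewrite [_ *: _](_ : _ = h^-1 * (f (z + h) - f z)) //.
    rewrite !mulrBr mulrA mulVf// mul1r; ring.
  rewrite normrN normrM normfV ltr_pdivrMl ?normr_gt0//.
  apply: le_lt_trans (hf _ he) _; rewrite expr2 mulrA mulrC ltr_pM2l ?normr_gt0//.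
  rewrite ltr_pdivlMr// in heps; apply: le_lt_trans heps.
  by rewrite mulrC ler_wpM2l// lerDl.
apply: DeriveDef; first by apply/cvg_ex; exists d.
by apply: (cvg_lim (@norm_hausdorff _ K^o)).
Unshelve. all: by end_near. Qed.

End QuadraticRemainder.

Section LogPotential.
Context {R : realType}.
Local Notation C := (plane R).
Implicit Types (z w h u : C).

Lemma quadratic_derivable (f : C -> C) z (d : C) (M e : R) : 0 <= M -> 0 < e ->
  (forall h, normc h <= e -> normc (f (z + h) - f z - h * d) <= M * normc h ^+ 2) ->
  derivable f z 1.
Proof.
move=> M0 e0 hf; have fd := @quadratic_is_derive R[i] f z d M%:C e%:C.
apply: (@ex_derive _ _ _ _ _ _ _ (fd _ _ _)); rewrite ?ler0c ?ltcR// => h.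
rewrite !normcE ltcR -rmorphXn -rmorphM lecR => /ltW; exact: hf.
Qed.

Lemma quadratic_derive1 (f : R -> R) (t d M e : R) : 0 <= M -> 0 < e ->
  (forall h : R, `|h| < e -> `|f (t + h) - f t - h * d| <= M * `|h| ^+ 2) ->
  derive1 f t = d.
Proof.
move=> M0 e0 hf; rewrite derive1E.
exact: (@derive_val _ _ _ _ _ _ _ (quadratic_is_derive M0 e0 hf)).
Qed.

Lemma normc_add1_sqr u :
  normc (1 + u) ^+ 2 = 1 + (2 * complex.Re u + normc u ^+ 2).
Proof.
case: u => a b; rewrite /= !sqr_sqrtr ?addr_ge0 ?sqr_ge0//.
by rewrite add0r; ring.
Qed.

(** With x = 2 Re u + |u|^2 one has ln |1+u| = ln (1+x) / 2, and x - 2 x^2 <= ln (1+x) <= x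
as soon as x >= -1/2. *)
Lemma ln_normc_add1 u : normc u <= 4^-1 ->
  `|ln (normc (1 + u)) - complex.Re u| <= 10 * normc u ^+ 2.
Proof.
move=> u4; have n0 := normc_ge0 u; have := normc_Re u.
set n : R := normc u in u4 n0 *; set a := complex.Re u.
rewrite ler_norml => /andP[an1 an2].
pose x := 2 * a + n ^+ 2.
have n2 : n ^+ 2 <= n / 4 by rewrite expr2; exact: ler_wpM2l.
have n20 : 0 <= n ^+ 2 by rewrite sqr_ge0.
have xl : - (1/2) <= x by rewrite /x; lra.
have x1 : 0 < 1 + x by lra.
have xn : `|x| <= 3 * n by rewrite ler_norml /x; apply/andP; split; lra.
have nu0 : 0 < normc (1 + u).
  rewrite lt_neqAle normc_ge0 andbT; apply/eqP => h.
  by have := normc_add1_sqr u; rewrite -h expr0n/= -/n -/a -/x; lra.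
have lnE : ln (normc (1 + u)) = ln (1 + x) / 2.
  have -> : 1 + x = normc (1 + u) ^+ 2 by rewrite normc_add1_sqr.
  by rewrite lnXn// -[_ *+ 2]mulr_natr mulfK.
have up : ln (1 + x) <= x by apply: le_ln1Dx; lra.
have lo : x - 2 * x ^+ 2 <= ln (1 + x).
  have : ln (1 + - (x / (1 + x))) <= - (x / (1 + x)).
    apply: le_ln1Dx; rewrite ltrN2 ltr_pdivrMr// mul1r; lra.
  have -> : 1 + - (x / (1 + x)) = (1 + x)^-1 by field; rewrite gt_eqF.
  rewrite lnV ?posrE// lerN2; apply: le_trans.
  rewrite ler_pdivlMr//; have := sqr_ge0 x; nra.
have x2 : x ^+ 2 <= 9 * n ^+ 2.
  rewrite -[x ^+ 2]real_normK ?num_real//.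
  have -> : 9 * n ^+ 2 = (3 * n) ^+ 2 by ring.
  by rewrite lerXn2r ?nnegrE ?mulr_ge0.
have n2E : normc u ^+ 2 = n ^+ 2 by [].
by rewrite lnE ler_norml /x in up lo x2 *; apply/andP; split; lra.
Qed.

Lemma ln_normc_shift z w h (r : R) : 0 < r -> r <= normc (z - w) -> normc h <= r / 4 ->
  `|ln (normc (z + h - w)) - ln (normc (z - w)) - complex.Re (h / (z - w))| <=
  10 * (normc h / r) ^+ 2.
Proof.
move=> r0 zwr hr; have zw0 : 0 < normc (z - w) by exact: lt_le_trans zwr.
have zwn0 : z - w != 0 by rewrite -normc_gt0.
have uh : normc (h / (z - w)) <= normc h / r.
  rewrite normc_div ler_wpM2l ?normc_ge0// lef_pV2 ?posrE//.
have u4 : normc (h / (z - w)) <= 4^-1.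
  by apply: le_trans uh _; rewrite ler_pdivrMr// mulrC.
have zhw : z + h - w = (z - w) * (1 + h / (z - w)) by field.
have u10 : 0 < normc (1 + h / (z - w)).
  have := normcD (1 + h / (z - w)) (- (h / (z - w))).
  by rewrite addrK normcN normc1; lra.
rewrite zhw normcM lnM ?posrE// [X in X - ln _]addrC addrK.
apply: le_trans (ln_normc_add1 u4) _; rewrite ler_pM2l//.
by rewrite lerXn2r ?nnegrE ?normc_ge0// divr_ge0 ?normc_ge0// ltW.
Qed.

End LogPotential.

Section LocalPotential.
Context {R : realType}.
Local Notation C := (plane R).
Variables (T : Type) (F : set_system T) (s : T -> seq C) (z0 : C) (r0 : R).
Context {FU : UltraFilter F}.
Hypothesis r0_gt0 : 0 < r0.
Implicit Types (z w h : C).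

Local Notation outer_lim := (outer_lim F s z0 r0).
Local Notation outer_bounded := (outer_bounded z0 r0).
Local Notation cauchy := (cauchy F s z0 r0).

Lemma near_outside_dist z w : normc (z - z0) < r0 / 8 -> outside z0 r0 w ->
  r0 / 2 <= normc (z - w).
Proof. by move=> zr wo; have r00 := r0_gt0; have h := outside_dist z wo; lra. Qed.

Lemma bounded_log_ratio z : normc (z - z0) < r0 / 8 ->
  exists B, outer_bounded (fun w => (ln (normc (z - w)) - ln (normc (z0 - w)))%:C) B.
Proof.
move=> zr; exists 2 => w wo; rewrite normc_real.
have r00 := r0_gt0; have r2 : 0 < r0 / 2 by rewrite divr_gt0.
have z0r : normc (z0 - z0) < r0 / 8 by rewrite subrr normc0 divr_gt0.
have zw := near_outside_dist z0r wo.
have hr : normc (z - z0) <= r0 / 2 / 4 by lra.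
have := ln_normc_shift r2 zw hr.
have -> : z0 + (z - z0) - w = z - w by ring.
have u1 : normc ((z - z0) / (z0 - w)) <= 1/4.
  rewrite normc_div ler_pdivrMr; last exact: lt_le_trans zw.
  by lra.
have := normc_Re ((z - z0) / (z0 - w)).
have n2 : (normc (z - z0) / (r0 / 2)) ^+ 2 <= 16^-1.
  have -> : 16^-1 = (4^-1) ^+ 2 :> R by field.
  rewrite lerXn2r ?nnegrE//; first by rewrite divr_ge0 ?normc_ge0// ltW.
  by rewrite ler_pdivrMr//; lra.
by rewrite !ler_norml => /andP[? ?] /andP[? ?]; apply/andP; split; lra.
Qed.

Variable P : C -> R.
Hypothesis PE : forall z, normc (z - z0) < r0 / 8 ->
  (P z - P z0)%:C = outer_lim (fun w => (ln (normc (z - w)) - ln (normc (z0 - w)))%:C).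

(** The second order expansion of the logarithmic kernel, averaged. *)
Lemma potential_quadratic z h : normc (z - z0) < r0 / 8 ->
  normc (z + h - z0) < r0 / 8 -> normc h <= r0 / 8 ->
  `|P (z + h) - P z - complex.Re (h * cauchy 0 z)| <= 40 / r0 ^+ 2 * normc h ^+ 2.
Proof.
move=> zr zhr hr; have r00 := r0_gt0; have zr0 : normc (z - z0) < r0 by lra.
have [B1 b1] := bounded_log_ratio zr; have [B2 b2] := bounded_log_ratio zhr.
have b3 := outer_boundedZ h (bounded_cauchy r0_gt0 0 zr0).
have b4 : outer_bounded (fun w => (complex.Re (h * ((w - z0)^-1 ^+ 0 * (z - w)^-1)))%:C)
   (normc h * (r0^-1 ^+ 0 * (r0 - normc (z - z0))^-1)).
  by move=> w /b3; apply: le_trans; rewrite normc_real normc_Re.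
rewrite -normc_real.
have -> : (P (z + h) - P z - complex.Re (h * cauchy 0 z))%:C =
    (P (z + h) - P z0)%:C - (P z - P z0)%:C - (complex.Re (h * cauchy 0 z))%:C :> C.
  by rewrite !rmorphB; ring.
rewrite !PE// -(outer_limZ s h (bounded_cauchy r0_gt0 0 zr0)) -(Re_outer_lim s b3).
rewrite -(outer_limB s b2 b1) -(outer_limB s (outer_boundedB b2 b1) b4).
apply: outer_lim_le => [|w wo].
  by rewrite mulr_ge0 ?exprn_ge0 ?normc_ge0// divr_ge0// exprn_ge0// ltW.
have -> (a b c x : R) : ((a - c)%:C - (b - c)%:C - x%:C : C) = (a - b - x)%:C.
  by rewrite !rmorphB; ring.
rewrite normc_real expr0 mul1r.
have zw := near_outside_dist zr wo.
have := @ln_normc_shift _ z w h (r0 / 2); rewrite divr_gt0// => /(_ isT zw).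
have -> : r0 / 2 / 4 = r0 / 8 by field.
move=> /(_ hr) /le_trans; apply; rewrite expr_div_n expr_div_n.
have -> : 10 * (normc h ^+ 2 / (r0 ^+ 2 / 2 ^+ 2)) = 40 / r0 ^+ 2 * normc h ^+ 2.
  by field; rewrite gt_eqF.
exact: lexx.
Qed.

(** By the quadratic expansion of P the partial derivatives of P at z are the real parts
of c and i c, where c is the Cauchy transform at z. *)
Lemma two_dz_potential z : normc (z - z0) < r0 / 8 -> two_dz P z = cauchy 0 z.
Proof.
move=> zr; have r00 := r0_gt0; pose d := r0 / 8 - normc (z - z0).
have d0 : 0 < d by rewrite subr_gt0.
have M0 : 0 <= 40 / r0 ^+ 2 by rewrite divr_ge0// exprn_ge0// ltW.
have step h : normc h < d -> normc (z + h - z0) < r0 / 8 /\ normc h <= r0 / 8.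
  move=> hd; have := normcD (z - z0) h; have := normc_ge0 (z - z0).
  by rewrite (addrAC z) /d in hd *; split; lra.
have dre : derive1 (fun t : R => P (z + t%:C)) 0 = complex.Re (cauchy 0 z).
  apply: (quadratic_derive1 M0 d0) => t td; rewrite add0r addr0.
  have tn : normc (t%:C : C) = `|t| by rewrite normc_real.
  have [h1 h2] : normc (z + t%:C - z0) < r0 / 8 /\ normc (t%:C : C) <= r0 / 8.
    by apply: step; rewrite tn.
  have := potential_quadratic zr h1 h2; rewrite tn.
  by case: (cauchy 0 z) => a b /=; rewrite mul0r subr0.
have dim : derive1 (fun t : R => P (z + 'i * t%:C)) 0 = - complex.Im (cauchy 0 z).
  apply: (quadratic_derive1 M0 d0) => t td; rewrite add0r rmorph0 mulr0 addr0.
  have tn : normc ('i * t%:C : C) = `|t|.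
    by rewrite normcM normc_real [normc 'i]/= expr0n expr1n add0r sqrtr1 mul1r.
  have [h1 h2] : normc (z + 'i * t%:C - z0) < r0 / 8 /\ normc ('i * t%:C : C) <= r0 / 8.
    by apply: step; rewrite tn.
  have := potential_quadratic zr h1 h2; rewrite tn.
  have -> // : complex.Re ('i * t%:C * cauchy 0 z) = t * - complex.Im (cauchy 0 z).
  by case: (cauchy 0 z) => a b /=; ring.
rewrite /two_dz; move: dre dim => -> ->; case: (cauchy 0 z) => a b /=.
by apply/eqP; rewrite eq_complex /=; apply/andP; split; apply/eqP; ring.
Qed.

(** Along the segment from z0 to z the quadratic expansion says that P has derivative
zero. *)
Lemma potential_constant : (forall z, normc (z - z0) < r0 / 8 -> cauchy 0 z = 0) ->
  forall z, normc (z - z0) < r0 / 8 -> P z = P z0.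
Proof.
move=> c0 z zr; have r00 := r0_gt0; pose v := z - z0; pose f (t : R) := P (z0 + t%:C * v).
have M0 : 0 <= 40 / r0 ^+ 2 * normc v ^+ 2.
  by rewrite mulr_ge0 ?exprn_ge0 ?normc_ge0// divr_ge0// exprn_ge0// ltW.
have v0 : 0 <= normc v by exact: normc_ge0.
have df (t : R) : t \in `[0, 1] -> is_derive t (1 : R) f (0 : R).
  rewrite in_itv/= => /andP[t0 t1].
  pose d := (r0 / 8 - normc v) / (normc v + 1).
  have v1 : 0 < normc v + 1 by rewrite ltr_wpDl.
  have d0 : 0 < d by rewrite divr_gt0 ?subr_gt0.
  apply: (quadratic_is_derive M0 d0) => h hd; rewrite mulr0 subr0.
  have hv : `|h| * normc v < r0 / 8 - normc v.
    move: hd; rewrite /d ltr_pdivlMr// mulrDr mulr1.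
    by have := normr_ge0 h; lra.
  have tv : normc (t%:C * v) <= normc v.
    by rewrite normcM normc_real ger0_norm// ler_piMl.
  have hvn : normc (h%:C * v) = `|h| * normc v by rewrite normcM normc_real.
  have zt : normc (z0 + t%:C * v - z0) < r0 / 8.
    by rewrite addrC addKr; apply: le_lt_trans zr.
  have zth : normc (z0 + t%:C * v + h%:C * v - z0) < r0 / 8.
    have -> : z0 + t%:C * v + h%:C * v - z0 = t%:C * v + h%:C * v by ring.
    apply: le_lt_trans (normcD _ _) _.
    by rewrite hvn; lra.
  have := potential_quadratic zt zth _; rewrite c0// mulr0 subr0 hvn.
  have -> : z0 + t%:C * v + h%:C * v = z0 + (t + h)%:C * v.
    by rewrite rmorphD mulrDl addrA.
  by rewrite exprMn mulrA mulrAC; apply; lra.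
have cf : {within `[(0 : R), 1], continuous f}.
  by apply: derivable_within_continuous => t /df [].
have df' (t : R) : t \in `](0 : R), 1[ -> is_derive t (1 : R) f ((fun=> 0 : R) t).
  by move=> t01; apply: df; exact: subset_itv_oo_cc.
have [t _] := @MVT_segment R f (fun=> 0) 0 1 ler01 df' cf.
rewrite mul0r => /eqP; rewrite subr_eq0 => /eqP.
by rewrite /f rmorph0 rmorph1 mul0r mul1r addr0 /v addrC subrK.
Qed.

End LocalPotential.

Section PotentialZero.
Context {R : realType}.
Local Notation C := (plane R).
Variables (T : Type) (F : set_system T) (s : T -> seq C) (z0 : C) (r0 : R).
Context {FU : UltraFilter F}.
Hypothesis r0_gt0 : 0 < r0.
Variable P : C -> R.
Hypothesis PE : forall z, normc (z - z0) < r0 / 8 ->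
  (P z - P z0)%:C = outer_lim F s z0 r0
    (fun w => (ln (normc (z - w)) - ln (normc (z0 - w)))%:C).

(** The Cauchy transform is (z-z0)^e [cauchy e z], and [cauchy e] is holomorphic with value
- [moment e] at z0. *)
Lemma zero_order_two_dz e : moment F s z0 r0 e != 0 ->
  (forall j, (j < e)%N -> moment F s z0 r0 j = 0) ->
  zero_order (two_dz P) z0 = e.
Proof.
move=> me mlt; have r00 := r0_gt0; have r8 : 0 < r0 / 8 by rewrite divr_gt0.
have near8 : \forall z \near z0, normc (z - z0) < r0 / 8 by exact: nbhs_disc.
apply: zero_order_unique; exists (cauchy F s z0 r0 e); split.
- apply: near_imp near8 => z zr; have zr0 : normc (z - z0) < r0 by lra.
  have quad := cauchy_quadratic (FU := FU) s r0_gt0 e zr0.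
  have d0 : 0 < r0 - normc (z - z0) by rewrite subr_gt0.
  apply: (quadratic_derivable _ _ quad); last by rewrite divr_gt0.
  by rewrite !mulr_ge0 ?exprn_ge0 ?invr_ge0 ?(ltW r0_gt0) ?(ltW d0).
- by rewrite cauchy_center// oppr_eq0.
apply: near_imp near8 => z zr; have zr0 : normc (z - z0) < r0 by lra.
rewrite (two_dz_potential r0_gt0 PE zr).
by have [-> _] := cauchy_factor (FU := FU) r0_gt0 zr0 mlt.
Qed.

End PotentialZero.

(** * Root distributions as measures *)

Section Measures.
Context {R : realType}.
Local Notation C := (plane R).
Local Notation B := (borel_plane R).
Implicit Types (z w : C) (p : {poly R[i]}).

Lemma open_measurable_plane (A : set C) : open A -> measurable (A : set B).
Proof. by move=> oA; exact: sub_sigma_algebra. Qed.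

Lemma closed_measurable_plane (A : set C) : closed A -> measurable (A : set B).
Proof.
move=> cA; rewrite -(setCK A); apply: measurableC.
by apply: open_measurable_plane; exact: closed_openC.
Qed.

Lemma continuous_measurable_plane (f : C -> R) : continuous f ->
  measurable_fun [set: B] (f : B -> R).
Proof.
move=> cf; apply: (measurability _ (RGenOInfty.measurableE R)) => //.
move=> _ [_ [a ->] <-]; rewrite setTI; apply: open_measurable_plane.
apply: open_comp => [w _|]; first exact: cf.
by rewrite set_itvE; exact: open_gt.
Qed.

Lemma ge0_integral_root_distribution p (f : C -> R) : continuous f ->
  (forall w, 0 <= f w) ->
  (\int[root_distribution p]_(w in setT) (f w)%:E =
   ((size p).-1%:R^-1 * \sum_(w <- poly_roots p) f w)%:E)%E.
Proof.
move=> cf f0; have mf : measurable_fun [set: B] (EFin \o f : B -> \bar R).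
  by apply/measurable_EFinP; exact: continuous_measurable_plane.
rewrite /root_distribution ge0_integral_mscale//; last first.
  by move=> w _; rewrite lee_fin.
rewrite /root_counting ge0_integral_measure_sum//; last first.
  by move=> w _; rewrite lee_fin.
rewrite EFinM; congr (_ * _)%E; rewrite (big_nth 0) big_mkord -sumEFin.
by apply: eq_bigr => i _; rewrite integral_dirac// diracT mul1e.
Qed.

Lemma Rintegral_root_distribution p (f : C -> R) : continuous f ->
  (\int[root_distribution p]_w f w)%R =
  (size p).-1%:R^-1 * \sum_(w <- poly_roots p) f w.
Proof.
move=> cf; rewrite /Rintegral integralE.
have cmax0 (g : C -> R) : continuous g -> continuous (fun w => Num.max (g w) 0).
  by move=> cg w; exact: (continuous_max (cg w) (@cst_continuous C R 0 w)).
have cpos := cmax0 _ cf.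
have cneg : continuous (fun w => Num.max (- f w) 0).
  by apply: cmax0 => w; exact: (continuousN (cf w)).
have pos0 w : 0 <= Num.max (f w) 0 by rewrite le_max lexx orbT.
have neg0 w : 0 <= Num.max (- f w) 0 by rewrite le_max lexx orbT.
have -> : (fun x : B => (f x)%:E)^\+%E = fun x => (Num.max (f x) 0)%:E.
  by apply/funext => x; rewrite unlock /= EFin_max.
have -> : (fun x : B => (f x)%:E)^\-%E = fun x => (Num.max (- f x) 0)%:E.
  by apply/funext => x; rewrite unlock /= EFin_max.
rewrite !ge0_integral_root_distribution// -EFinB/= -mulrBr -sumrB.
congr (_ * _); apply: eq_bigr => w _.
by rewrite !maxEge; case: (leP 0 (f w)) => h1; case: (leP 0 (- f w)) => h2; lra.
Qed.

(** Extension by 0 at infinity turns functions that vanish at infinity into test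
functions on the sphere. *)
Lemma continuous_sphere_ext (f : C -> R) : continuous f ->
  (forall e, 0 < e -> exists r, forall w, r < normc w -> `|f w| < e) ->
  continuous (fun x : sphere R => if x is Some w then f w else 0).
Proof.
move=> cf finf [w|] A.
  by move=> /cf; exact.
move=> /nbhs_ballP[e /= e0 eA]; have [r hr] := finf _ e0.
exists [set w : C | normc (w - 0) <= r].
  by split; [exact: compact_cdisc|exact: closed_cdisc].
move=> _ [[w /= wr <-]|->] /=; apply: eA; rewrite -ball_normE /ball_/= sub0r normrN.
  by apply: hr; rewrite ltNge; move/negP: wr; rewrite subr0.
by rewrite normr0.
Qed.

Lemma root_countingE p (K : set C) :
  root_counting p K = (count (fun w => w \in K) (poly_roots p))%:R%:E.
Proof.
rewrite /root_counting /msum -sum1_count natr_sum (big_nth 0) big_mkord.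
rewrite [in RHS]big_mkcond -sumEFin /=; apply: eq_bigr => i _.
transitivity (((poly_roots p)`_i \in K)%:R%:E : \bar R); last by case: (_ \in K).
exact: (@diracE _ B R).
Qed.

Lemma continuous_normcB z : continuous (fun w : C => normc (z - w)).
Proof.
rewrite (_ : (fun w : C => normc (z - w)) = (fun w : C => normc (w - z))).
  exact: continuous_normc.
by apply/funext => w; rewrite normcB.
Qed.

Lemma measurable_log_dist z :
  measurable_fun [set: B] (fun w : B => lne (complex.Re `|(z : C) - w|)%:E).
Proof.
have mn := continuous_measurable_plane (@continuous_normcB z).
have -> : (fun w : B => lne (complex.Re `|(z : C) - w|)%:E) =
    (fun w : B => if normc ((z : C) - w) <= 0 then -oo%E
                  else (ln (normc ((z : C) - w)))%:E) by [].
apply: measurable_fun_ifT.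
- by apply: measurable_fun_ler => //; exact: measurable_cst.
- exact: measurable_cst.
- by apply/measurable_EFinP; apply: measurableT_comp mn; exact: measurable_ln.
Qed.

(** A finite subcover by null open sets. *)
Lemma negligible_compact (mu : {measure set B -> \bar R}) (K : set C) :
  compact K -> (forall w, K w -> exists V : set C, [/\ open V, V w & mu V = 0]) ->
  mu.-negligible (K : set B).
Proof.
rewrite compact_cover => cK hK.
have /choice[V VP] : forall w, exists V : set C, K w -> [/\ open V, V w & mu V = 0].
  by move=> w; have [/hK[V ?]|?] := pselect (K w); [exists V|exists set0].
have [|w Kw|D DK KD] := cK C K V.
- by move=> w /VP[].
- by exists w => //; have [] := VP w Kw.
pose s := finmap.enum_fset D.
pose G k : set B := if (k < size s)%N then V s`_k else set0.
apply: (@negligibleS _ _ _ _ (\bigcup_k G k)).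
  move=> w /KD[v /= vD Vw]; exists (index v s) => //.
  by rewrite /G index_mem [v \in s]vD nth_index.
apply: negligible_bigcup => k; rewrite /G; case: ltnP => ks; last exact: negligible_set0.
have sk : s`_k \in s by exact: mem_nth.
have := DK s`_k; rewrite inE => /(_ sk) /VP[oV _ V0]; apply/negligibleP => //.
exact: open_measurable_plane.
Qed.

Lemma compact_bounded_plane (K : set C) : compact K ->
  exists r : R, forall w, K w -> normc w < r.
Proof.
rewrite compact_cover => cK.
have [|w Kw|D _ KD] := cK nat [set: nat] (fun n => disc (0 : C) n%:R).
- by move=> n _; exact: open_disc.
- exists (Num.trunc (normc w)).+1 => //; rewrite /disc/= subr0.
  by rewrite truncnS_gt.
exists (\sum_(n <- finmap.enum_fset D) n%:R + 1) => w /KD[n /= nD].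
rewrite /disc/= subr0 => wn; apply: (lt_trans wn).
rewrite ltr_pwDr// (big_rem n)//= lerDl sumr_ge0// => i _; exact: ler0n.
Qed.

(** The complement of the disc is a countable union of compact sets that do not meet the
support. *)
Lemma negligible_outside_support (mu : {measure set B -> \bar R}) :
  compact (measure_support mu) ->
  exists2 r : R, 0 < r & mu.-negligible ((~` disc (0 : C) r) : set B).
Proof.
move=> /compact_bounded_plane[r hr]; pose r' := `|r| + 1.
have r'0 : 0 < r' by rewrite ltr_pwDr.
exists r' => //.
pose A (n : nat) : set C := [set w | normc (w - 0) <= n%:R] `&` ~` disc (0 : C) r'.
apply: (@negligibleS _ _ _ _ (\bigcup_n (A n : set B))).
  move=> w wr; exists (Num.trunc (normc w)).+1 => //; split => //=.
  by rewrite subr0 ltW// truncnS_gt.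
apply: negligible_bigcup => n; apply: negligible_compact.
  apply: (subclosed_compact _ (@compact_cdisc R 0 n%:R)); last by move=> w [].
  by apply: closedI; [exact: closed_cdisc|apply: open_closedC; exact: open_disc].
move=> w [_ wr']; have : ~ measure_support mu w.
  move=> /hr wr; apply: wr'; rewrite /disc/= subr0 (lt_le_trans wr)//.
  by rewrite (le_trans (ler_norm r))// lerDl.
move=> /existsNP[V] /not_implyP[oV] /not_implyP[Vw] V0.
exists V; split => //; apply/eqP; rewrite eq_le measure_ge0 andbT leNgt.
exact/negP.
Qed.

End Measures.

(** * The potential of the weak* limit *)

Section WeakStar.
Context {R : realType}.
Local Notation C := (plane R).
Local Notation B := (borel_plane R).
Variables (q : nat -> {poly R[i]}) (mu : probability B R).
Hypothesis q_monic : forall k, q k \is monic.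
Hypothesis degq_gt0 : forall k, (0 < (size (q k)).-1)%N.
Hypothesis degq_infty : (size (q k)).-1 @[k --> \oo] --> \oo.
Hypothesis weak_cvg : weak_star_cvg (fun k => root_distribution (q k)) mu.
Implicit Types (z w : C).

Local Notation deg k := (size (q k)).-1.

Lemma size_poly_roots (p : {poly R[i]}) : p != 0 -> size (poly_roots p) = (size p).-1.
Proof.
move=> p0; rewrite [in RHS](poly_rootsE p) size_scale ?lead_coef_eq0//.
by rewrite size_prod_XsubC.
Qed.

Lemma inv_degree_cvg0 : (fun k => (deg k)%:R^-1 : R) @ \oo --> (0 : R).
Proof.
apply/cvgrPdist_lt => e e0.
have h : \forall k \near \oo, ((Num.trunc e^-1).+1 <= deg k)%N.
  by have [+ _] := cvgnyPge (F := \oo) (fun k => deg k); apply.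
apply: near_imp h => k hk; rewrite sub0r normrN ger0_norm ?invr_ge0//.
rewrite invf_plt ?posrE ?ltr0n//.
by apply: lt_le_trans (truncnS_gt _) _; rewrite ler_nat.
Qed.

Lemma mean_cvg_integral (f : C -> R) : continuous f ->
  (forall e, 0 < e -> exists r, forall w, r < normc w -> `|f w| < e) ->
  (fun k => (deg k)%:R^-1 * \sum_(w <- poly_roots (q k)) f w) @ \oo -->
  (\int[mu]_w f w)%R.
Proof.
move=> cf finf; have := weak_cvg (continuous_sphere_ext cf finf).
by under eq_fun do rewrite Rintegral_root_distribution//.
Qed.

Lemma integrable_bounded_off_null (N : set B) (f : B -> R) (r : R) :
  measurable N -> mu N = 0 -> measurable_fun [set: B] f ->
  (forall w, ~ N w -> `|f w| <= r) -> mu.-integrable [set: B] (EFin \o f).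
Proof.
move=> mN N0 mf fr; have mEf : measurable_fun [set: B] (EFin \o f) by exact/measurable_EFinP.
apply/(negligible_integrable mN measurableT mEf N0).
have mTN : measurable ([set: B] `\` N) by exact: measurableD.
apply: (measurable_bounded_integrable mTN).
- exact: (le_lt_trans (probability_le1 mu mTN) (ltry 1)).
- exact: measurable_funTS.
exists r; split; first exact: num_real.
by move=> M rM w [_ Nw]; apply: le_trans (fr w Nw) (ltW rM).
Qed.

Section Disc.
Variables (z0 : C) (r0 : R) (N : nat).
Hypothesis r0_gt0 : 0 < r0.
Hypothesis few_roots : \forall k \near \oo, (disc_count (poly_roots (q k)) z0 r0 <= N)%N.

(** At most N of the n_k roots lie in the disc. *)
Lemma inner_mean_cvg0 (f : C -> R) (M : R) :
  (forall w, normc (w - z0) < r0 -> `|f w| <= M) ->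
  (fun k => (deg k)%:R^-1 *
     \sum_(w <- poly_roots (q k) | normc (w - z0) < r0) f w) @ \oo --> (0 : R).
Proof.
move=> fM; have M0 : 0 <= M.
  by apply: le_trans (fM z0 _); rewrite ?normr_ge0// subrr normc0.
have d0 : (fun k => N%:R * M * (deg k)%:R^-1) @ \oo --> (0 : R).
  rewrite -[X in _ --> X](mulr0 (N%:R * M)).
  by apply: cvgM; [exact: cvg_cst|exact: inv_degree_cvg0].
apply/cvgrPdist_lt => e e0.
have /cvgrPdist_lt/(_ _ e0) h := d0.
near=> k; have hk : (disc_count (poly_roots (q k)) z0 r0 <= N)%N by near: k.
have : `|0 - N%:R * M * (deg k)%:R^-1| < e by near: k.
rewrite !sub0r !normrN => /(le_lt_trans _); apply.
rewrite [leRHS]ger0_norm ?mulr_ge0 ?invr_ge0//.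
rewrite normrM ger0_norm ?invr_ge0// mulrC ler_wpM2r ?invr_ge0//.
apply: le_trans (ler_norm_sum _ _ _) _.
apply: (@le_trans _ _ (\sum_(w <- poly_roots (q k) | normc (w - z0) < r0) M)).
  by apply: ler_sum => w; exact: fM.
rewrite big_const_seq iter_addr_0 -[M *+ _]mulr_natl ler_wpM2r// ler_nat.
exact: hk.
Unshelve. all: by end_near. Qed.

(** The tent function r0 - |w-z0| vanishes outside the disc, so its means over the roots
tend to 0, and its integral is 0 although it is positive on the disc. *)
Lemma disc_null : mu (disc z0 r0) = 0.
Proof.
pose f w := Num.max (r0 - normc (w - z0)) 0.
have cf : continuous f.
  move=> w; apply: (continuous_max _ (@cst_continuous C R 0 w)).
  by apply: continuousB; [exact: cst_continuous|exact: continuous_normc].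
have f0 w : 0 <= f w by rewrite le_max lexx orbT.
have fin w : normc (w - z0) < r0 -> f w = r0 - normc (w - z0).
  by move=> wr; rewrite /f maxEge; case: leP => //; lra.
have fout w : ~~ (normc (w - z0) < r0) -> f w = 0.
  by rewrite -leNgt => wr; rewrite /f maxEge; case: leP => //; lra.
have finf e : 0 < e -> exists r, forall w, r < normc w -> `|f w| < e.
  move=> e0; exists (r0 + normc z0) => w wr; rewrite fout ?normr0//.
  by rewrite -leNgt; have := normc_dist_le w 0 z0; rewrite !subr0; lra.
have h1 := mean_cvg_integral cf finf.
have h2 : (fun k => (deg k)%:R^-1 * \sum_(w <- poly_roots (q k)) f w) @ \oo --> (0 : R).
  have -> : (fun k => (deg k)%:R^-1 * \sum_(w <- poly_roots (q k)) f w) =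
    (fun k => (deg k)%:R^-1 * \sum_(w <- poly_roots (q k) | normc (w - z0) < r0) f w).
    apply/funext => k; congr (_ * _); rewrite [RHS]big_mkcond.
    by apply: eq_bigr => w _; case: ifPn => // /fout.
  apply: (@inner_mean_cvg0 _ r0) => w wr; rewrite fin// ger0_norm; last by lra.
  by have := normc_ge0 (w - z0); lra.
have int0 : (\int[mu]_w f w)%R = 0 by exact: (cvg_unique (@Rhausdorff R) h1 h2).
have mf : measurable_fun [set: B] (f : B -> R) by exact: continuous_measurable_plane.
have intf : mu.-integrable [set: B] (EFin \o f : B -> \bar R).
  apply: (@integrable_bounded_off_null set0 _ r0) => // w _.
  rewrite ger0_norm// /f ge_max (ltW r0_gt0) andbT lerBlDr lerDl.
  exact: normc_ge0.
have : (\int[mu]_(w in setT) (f w)%:E = 0)%E.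
  have := integrable_fin_num measurableT intf.
  by move: int0; rewrite /Rintegral => + /fineK <- /= => ->.
have -> : (fun w : B => (f w)%:E) = (fun w : B => `|(EFin \o f) w|)%E.
  by apply/funext => w /=; rewrite ger0_norm.
have mEf : measurable_fun [set: B] (EFin \o f : B -> \bar R) by exact/measurable_EFinP.
move/(ae_eq_integral_abs _ measurableT mEf) => ae0.
have mD : measurable (disc z0 r0 : set B).
  by apply: open_measurable_plane; exact: open_disc.
apply/(negligibleP _ mD); apply: (negligibleS _ ae0) => w /= wr /(_ I)/= [].
by rewrite fin//; move: wr; rewrite /disc/= => wr; lra.
Qed.

(** A continuous kernel which differs from ln |z-w| only for |z-w| < r0/2, that is, for z
near z0, only in the null disc. *)
Definition capped_log z w : R := ln (Num.max (normc (z - w)) (r0 / 2)).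

Lemma ln_lipschitz (a b m : R) : 0 < m -> m <= a -> m <= b ->
  `|ln a - ln b| <= `|a - b| / m.
Proof.
move=> m0; wlog ab : a b / b <= a => [H ma mb|ma mb].
  have [ba|ab] := leP b a; first exact: H.
  by rewrite distrC (distrC a); apply: H => //; exact: ltW.
have a0 : 0 < a by exact: lt_le_trans ma.
have b0 : 0 < b by exact: lt_le_trans mb.
rewrite !ger0_norm ?subr_ge0 ?ler_ln ?posrE// -ln_div ?posrE//.
have -> : a / b = 1 + (a - b) / b by field; rewrite gt_eqF.
apply: (@le_trans _ _ ((a - b) / b)).
  apply: le_ln1Dx; apply: (@lt_le_trans _ _ 0); rewrite ?ltrN10//.
  by rewrite divr_ge0 ?subr_ge0// ltW.
by rewrite ler_wpM2l ?subr_ge0// lef_pV2 ?posrE.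
Qed.

Lemma max_dist_le (a b c : R) : `|Num.max a c - Num.max b c| <= `|a - b|.
Proof.
rewrite ler_norml; move: (ler_norm (a - b)) (ler_norm (b - a)).
rewrite (distrC b) !maxEge; set d : R := `|a - b| => h1 h2.
by case: (leP c a) => h3; case: (leP c b) => h4; apply/andP; split; lra.
Qed.

Lemma half_r0_gt0 : 0 < r0 / 2.
Proof. by rewrite divr_gt0. Qed.

Lemma continuous_capped_log z : continuous (capped_log z).
Proof.
move=> w; apply: (@continuous_comp _ _ _ (fun w => Num.max (normc (z - w)) (r0 / 2)) (@ln R)).
  apply: (continuous_max _ (@cst_continuous C R (r0 / 2) w)).
  exact: continuous_normcB.
by apply: continuous_ln; rewrite lt_max half_r0_gt0 orbT.
Qed.

Lemma capped_log_diff_le z z' w m : 0 < m ->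
  m <= Num.max (normc (z - w)) (r0 / 2) -> m <= Num.max (normc (z' - w)) (r0 / 2) ->
  `|capped_log z w - capped_log z' w| <= normc (z - z') / m.
Proof.
move=> m0 mz mz'; apply: le_trans (ln_lipschitz m0 mz mz') _.
rewrite ler_wpM2r ?invr_ge0 ?(ltW m0)//; apply: le_trans (max_dist_le _ _ _) _.
rewrite ler_norml; have := normc_dist_le z w z'; have := normc_dist_le z' w z.
by rewrite (normcB z' z) => h1 h2; apply/andP; split; lra.
Qed.

Lemma capped_log_diff_bound z z' w :
  `|capped_log z w - capped_log z' w| <= normc (z - z') / (r0 / 2).
Proof.
by apply: capped_log_diff_le; rewrite ?half_r0_gt0// le_max lexx orbT.
Qed.

(** A single logarithm is unbounded at infinity, but a difference of two of them is a
test function. *)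
Lemma capped_log_diff_infty z z' e : 0 < e -> exists r, forall w, r < normc w ->
  `|capped_log z w - capped_log z' w| < e.
Proof.
move=> e0; exists (normc z + normc z' + normc (z - z') / e) => w wr.
have := normc_ge0 z; have := normc_ge0 z' => z0' z00.
have d0 : 0 <= normc (z - z') / e by rewrite divr_ge0 ?normc_ge0// ltW.
pose m := normc w - (normc z + normc z').
have md : normc (z - z') / e < m by rewrite /m; lra.
have m0 : 0 < m by lra.
have le1 u : normc (u - w) >= normc w - normc u.
  by have := normcD (u - w) (- u); rewrite addrAC subrr sub0r !normcN; lra.
apply: (@le_lt_trans _ _ (normc (z - z') / m)).
  apply: capped_log_diff_le => //; rewrite le_max; apply/orP; left.
    by have := le1 z; rewrite /m; lra.
  by have := le1 z'; rewrite /m; lra.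
by rewrite ltr_pdivrMr// mulrC -ltr_pdivrMr.
Qed.

Hypothesis mu_support : compact (measure_support mu).

Lemma integrable_capped_log z :
  mu.-integrable [set: B] (EFin \o (capped_log z : B -> R)).
Proof.
have [r r_gt0 nr] := negligible_outside_support mu_support.
have mN : measurable ((~` disc (0 : C) r) : set B).
  by apply: closed_measurable_plane; apply: open_closedC; exact: open_disc.
have N0 : mu (~` disc (0 : C) r) = 0 by apply/(negligibleP _ mN).
apply: (@integrable_bounded_off_null _ _ (`|ln (r0 / 2)| + (normc z + r) / (r0 / 2)) mN N0).
  by apply: continuous_measurable_plane; exact: continuous_capped_log.
move=> w /contrapT; rewrite /disc/= subr0 => wr.
have -> : capped_log z w = ln (r0 / 2) + (capped_log z w - ln (r0 / 2)).
  by rewrite addrC subrK.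
apply: le_trans (ler_normD _ _) _; rewrite lerD2l.
apply: le_trans (ln_lipschitz half_r0_gt0 _ (lexx _)) _.
  by rewrite le_max lexx orbT.
rewrite ler_wpM2r ?invr_ge0 ?(ltW half_r0_gt0)//.
rewrite ger0_norm ?subr_ge0 ?le_max ?lexx ?orbT//.
have := half_r0_gt0; have := normcD z (- (w : C)); rewrite normcN maxEge.
have := normc_ge0 z; have := normc_ge0 (w : C).
by case: (leP (r0 / 2) (normc (z - w))) => h1 h2 h3 h4 h5; lra.
Qed.

Lemma potential_capped_log z : normc (z - z0) < r0 / 8 ->
  potential mu z = (\int[mu]_w (capped_log z w)%:E)%E.
Proof.
move=> zr; apply: ae_eq_integral => //.
- exact: measurable_log_dist.
- apply/measurable_EFinP; apply: continuous_measurable_plane.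
  exact: continuous_capped_log.
have mD : measurable (disc z0 r0 : set B).
  by apply: open_measurable_plane; exact: open_disc.
exists (disc z0 r0); split => //; first exact: disc_null.
move=> w /= nw; apply: contrapT => wr; apply: nw => _.
have r00 := r0_gt0; move: wr; rewrite /disc/= => /negP; rewrite -leNgt => wr.
have zw : r0 / 2 <= normc (z - w).
  by have h := normc_dist_le (w : C) z0 z; rewrite (normcB (w : C) z) in h; lra.
have zw0 := lt_le_trans half_r0_gt0 zw.
by rewrite leNgt zw0 /= /capped_log (max_idPl zw).
Qed.

Lemma potential_fin_num z : normc (z - z0) < r0 / 8 -> potential mu z \is a fin_num.
Proof.
move=> zr; rewrite potential_capped_log//.
exact: (integrable_fin_num measurableT (integrable_capped_log z)).
Qed.

(** Apply weak* convergence to the difference of the capped logarithms. The roots in the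
disc do not contribute to the limit of the means, and on the others the caps are not
active. *)
Lemma potential_diff_outer_lim (F : set_system nat) {FU : UltraFilter F} z :
  \oo `<=` F -> normc (z - z0) < r0 / 8 ->
  (fine (potential mu z) - fine (potential mu z0))%:C =
  outer_lim F (fun k => poly_roots (q k)) z0 r0
    (fun w => (ln (normc (z - w)) - ln (normc (z0 - w)))%:C).
Proof.
move=> ooF zr; have r00 := r0_gt0.
have z0r : normc (z0 - z0) < r0 / 8 by rewrite subrr normc0 divr_gt0.
pose f w := capped_log z w - capped_log z0 w.
have cf : continuous f.
  by move=> w; apply: continuousB; exact: continuous_capped_log.
have h1 := mean_cvg_integral cf (fun e => @capped_log_diff_infty z z0 e).
have h2 := inner_mean_cvg0 (fun w _ => capped_log_diff_bound z z0 w).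
have intf : (\int[mu]_w f w)%R = fine (potential mu z) - fine (potential mu z0).
  rewrite !potential_capped_log//.
  by rewrite (RintegralB measurableT (integrable_capped_log z) (integrable_capped_log z0)).
have h3 : (fun k => (deg k)%:R^-1 *
    \sum_(w <- poly_roots (q k) | outside z0 r0 w) f w) @ F -->
    fine (potential mu z) - fine (potential mu z0).
  have h12 := cvgB (FF := eventually_filter) h1 h2; rewrite subr0 intf in h12.
  have := cvg_trans (cvg_app _ ooF) h12.
  apply: cvg_trans; apply: near_eq_cvg; apply: nearW => k /=.
  transitivity ((deg k)%:R^-1 * \sum_(w <- poly_roots (q k)) f w -
    (deg k)%:R^-1 * \sum_(w <- poly_roots (q k) | normc (w - z0) < r0) f w) => //.
  rewrite -mulrBr [X in X - _](bigID (fun w => normc (w - z0) < r0)) /=.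
  rewrite [X in X - _]addrC addrK.
  by congr (_ * _); apply: eq_bigl => w; rewrite /outside leNgt.
symmetry; apply: outer_limE; have := cvg_comp _ _ h3 (@continuous_real_complex R _).
apply: cvg_trans; apply: near_eq_cvg; apply: nearW => k /=.
rewrite /outer_mean size_poly_roots ?monic_neq0// rmorphM fmorphV rmorph_nat rmorph_sum.
congr (_ * _); apply: eq_bigr => w wo.
have cap u : normc (u - z0) < r0 / 8 -> capped_log u w = ln (normc (u - w)).
  move=> ur; rewrite /capped_log (max_idPl _)//.
  by have h := outside_dist u wo; lra.
by rewrite /f !cap.
Qed.

End Disc.
End WeakStar.

(** * Clusters of the roots of the derivatives *)

Section PowerSums.
Context {R : realType}.
Local Notation C := (plane R).
Variables (q : nat -> {poly R[i]}) (F : set_system nat) (z0 : C) (r0 : R) (d : nat).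
Context {FU : UltraFilter F}.
Implicit Types (z w u : C).

Local Notation s := (fun k => poly_roots (q k)).
Local Notation n := (fun k => (size (poly_roots (q k)))%:R : C).

Hypothesis q_neq0 : forall k, q k != 0.
Hypothesis roots_gt0 : forall k, (0 < size (poly_roots (q k)))%N.
Hypothesis inv_size_cvg0 : (fun k => (n k)^-1) @ F --> (0 : C).
Hypothesis cluster : cluster_radius F s z0 d r0.

Lemma exprB_le (x y : C) (B : R) j : normc x <= B -> normc y <= B ->
  normc (x ^+ j - y ^+ j) <= j%:R * B ^+ j.-1 * normc (x - y).
Proof.
move=> xB yB; have B0 := le_trans (normc_ge0 x) xB.
rewrite subrXX normcM mulrC ler_wpM2r ?normc_ge0//.
apply: le_trans (normc_sum _ _ _) _.
have -> : j%:R * B ^+ j.-1 = \sum_(i < j) B ^+ j.-1.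
  by rewrite sumr_const card_ord mulr_natl.
apply: ler_sum => -[i /= ij] _; rewrite normcM !normcX.
have -> : B ^+ j.-1 = B ^+ (j.-1 - i) * B ^+ i by rewrite -exprD; congr (_ ^+ _); lia.
by rewrite ler_pM ?exprn_ge0 ?normc_ge0// lerXn2r ?nnegrE ?normc_ge0.
Qed.

Lemma inner_roots_close r : 0 < r -> r <= r0 -> \forall k \near F,
  forall w, w \in poly_roots (q k) -> normc (w - z0) < r0 -> normc (w - z0) < r.
Proof.
move=> r_gt0 rr0; have [r0_gt0 hd] := cluster.
apply: near_imp (near_and (hd r r_gt0 rr0) (hd r0 r0_gt0 (lexx _))) => k [h1 h2].
move=> w ws w0; apply: contrapT => wr.
have : (disc_count (poly_roots (q k)) z0 r < disc_count (poly_roots (q k)) z0 r0)%N.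
  by apply: (count_lt _ ws w0 wr) => u /lt_le_trans; apply.
by rewrite h1 h2 ltnn.
Qed.

(** The d roots in the disc are within r/2 of z0, hence at distance at least r/2 of
z k, and d/n_k tends to 0. *)
Lemma inner_psum_cvg0 (z : nat -> C) r j : 0 < r -> r <= r0 ->
  (\forall k \near F, normc (z k - z0) = r) ->
  (fun k => (n k)^-1 * \sum_(w <- s k | normc (w - z0) < r0) (z k - w)^-1 ^+ j)
    @ F --> (0 : C).
Proof.
move=> r_gt0 rr0 zr; have r2 : 0 < r / 2 by rewrite divr_gt0.
have [r0_gt0 hd] := cluster.
under eq_fun do rewrite mulrC.
apply: (@cvg0_bounded R _ F _ _ _ (d%:R * (r / 2)^-1 ^+ j) inv_size_cvg0).
have r2r0 : r / 2 <= r0 by lra.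
apply: near_imp (near_and (near_and zr (inner_roots_close r2 r2r0)) (hd r0 r0_gt0 (lexx _))).
move=> k [[zk close] dk]; apply: le_trans (normc_sum _ _ _) _.
rewrite -[in d%:R]dk /disc_count -sum1_count natr_sum mulr_suml.
rewrite big_seq_cond [leRHS]big_seq_cond; apply: ler_sum => w /andP[ws w0].
rewrite mul1r normcX normcV lerXn2r ?nnegrE ?invr_ge0 ?normc_ge0 ?(ltW r2)//.
have wr := close w ws w0; have h := normc_dist_le (z k) z0 w.
rewrite (normcB w) in wr *.
have zw : r / 2 <= normc (z k - w).
  by move: h; rewrite zk (normcB w z0); lra.
by rewrite lef_pV2 ?posrE// (lt_le_trans r2 zw).
Qed.

(** The kernel is Lipschitz in z, uniformly over the distant roots, so that z k may be
replaced by its limit l. *)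
Lemma outer_psum_cvg (z : nat -> C) (l : C) j :
  normc (l - z0) <= r0 / 2 -> z @ F --> l ->
  (\forall k \near F, normc (z k - z0) <= r0 / 2) ->
  (fun k => (n k)^-1 * \sum_(w <- s k | outside z0 r0 w) (z k - w)^-1 ^+ j) @ F -->
  outer_lim F s z0 r0 (fun w => (l - w)^-1 ^+ j).
Proof.
move=> lr zl zr; have [r0_gt0 _] := cluster.
have r2 : 0 < r0 / 2 by rewrite divr_gt0.
pose B := (r0 / 2)^-1.
have B0 : 0 <= B by rewrite invr_ge0 ltW.
have kernel u : normc (u - z0) <= r0 / 2 -> outer_bounded z0 r0 (fun w => (u - w)^-1) B.
  move=> ur w wo; have h := outside_dist u wo; have h' : r0 / 2 <= normc (u - w) by lra.
  by rewrite normcV lef_pV2 ?posrE// (lt_le_trans r2 h').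
have main := cvg_outer_mean (FU := FU) (s := s) (outer_boundedX j B0 (kernel _ lr)).
have diff : (fun k => outer_mean s z0 r0 (fun w => (z k - w)^-1 ^+ j - (l - w)^-1 ^+ j) k)
    @ F --> (0 : C).
  apply/cvg_normcP => e e0.
  pose K := j%:R * B ^+ j.-1 * B ^+ 2 + 1.
  have K0 : 0 < K by rewrite ltr_wpDl// !mulr_ge0 ?exprn_ge0.
  move/cvg_normcP: zl => /(_ _ (divr_gt0 e0 K0)) zl.
  apply: near_imp (near_and zl zr) => k [zlk zrk]; rewrite sub0r normcN.
  apply: (@le_lt_trans _ _ (j%:R * B ^+ j.-1 * B ^+ 2 * normc (l - z k))); last first.
    move: zlk; rewrite ltr_pdivlMr// => /(le_lt_trans _); apply.
    by rewrite mulrC ler_wpM2l ?normc_ge0// lerDl.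
  apply: outer_mean_le => [|w wo].
    by rewrite !mulr_ge0 ?exprn_ge0 ?normc_ge0.
  apply: le_trans (exprB_le j (kernel _ zrk w wo) (kernel _ lr w wo)) _.
  rewrite -!mulrA ler_wpM2l// ler_wpM2l ?exprn_ge0//.
  have zw0 : z k - w != 0 by apply: outside_dist_neq0 wo; lra.
  have lw0 : l - w != 0 by apply: outside_dist_neq0 wo; lra.
  have -> : (z k - w)^-1 - (l - w)^-1 = (z k - w)^-1 * (l - w)^-1 * (l - z k).
    by field; rewrite lw0.
  rewrite mulrA normcM ler_wpM2r ?normc_ge0// normcM.
  by rewrite ler_pM ?normc_ge0 ?kernel.
have /(_ _) := cvg_addC diff main; rewrite add0r; apply: cvg_trans; apply: near_eq_cvg.
apply: nearW => k; rewrite /outer_mean -mulrDr -big_split /=; congr (_ * _).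
by apply: eq_bigr => w _; rewrite subrK.
Qed.

Lemma psum_cvg (z : nat -> C) (l : C) r j : 0 < r -> r <= r0 / 2 ->
  normc (l - z0) <= r0 / 2 -> z @ F --> l ->
  (\forall k \near F, normc (z k - z0) = r) ->
  (fun k => psum (inverse_dists (q k) (z k)) j / n k) @ F -->
  outer_lim F s z0 r0 (fun w => (l - w)^-1 ^+ j).
Proof.
move=> r_gt0 rr0 lr zl zr; have [r0_gt0 _] := cluster.
have rr : r <= r0 by lra.
have zr2 : \forall k \near F, normc (z k - z0) <= r0 / 2.
  by apply: near_imp zr => k ->.
have h1 := inner_psum_cvg0 j r_gt0 rr zr.
have h2 := outer_psum_cvg (j := j) lr zl zr2.
have /(_ _) := cvg_addC h1 h2; rewrite add0r; apply: cvg_trans.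
apply: near_eq_cvg; apply: nearW => k; rewrite /psum /inverse_dists big_map.
rewrite [RHS]mulrC [in RHS](bigID (fun w => normc (w - z0) < r0)) /= mulrDr.
congr (_ + _ * _); apply: eq_bigl => w; by rewrite /outside leNgt.
Qed.

Local Notation cauchy := (cauchy F s z0 r0).
Local Notation cauchy' := (cauchy' F s z0 r0).
Local Notation moment := (moment F s z0 r0).

Variables (e m : nat).
Hypothesis moment_e : moment e != 0.
Hypothesis moment_lt : forall j, (j < e)%N -> moment j = 0.

(** Near z0 the logarithmic derivative of [cauchy 0] is e/(z-z0) plus a bounded term, the
logarithmic derivative of [cauchy e]. The last inequality makes the latter, times
m (z-z0), smaller than 1/4. *)
Lemma cauchy_nbhs : \forall z \near z0, [/\ normc (z - z0) <= r0 / 2,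
  cauchy e z != 0 & m%:R * normc (z - z0) * normc (cauchy' e z) < normc (cauchy e z) / 4].
Proof.
have [r0_gt0 _] := cluster; have r2 : 0 < r0 / 2 by rewrite divr_gt0.
pose a := normc (moment e).
have a0 : 0 < a by rewrite normc_gt0.
(* K bounds cauchy' e on the disc of radius r0 / 2. *)
pose K := r0^-1 ^+ e * (r0 / 2)^-1 ^+ 2.
have K0 : 0 <= K by rewrite mulr_ge0 ?exprn_ge0 ?invr_ge0 ?(ltW r2) ?(ltW r0_gt0).
have c0 : cauchy e z0 = - moment e by exact: cauchy_center.
have z00 : normc (z0 - z0) < r0 by rewrite subrr normc0.
have hc : \forall z \near z0, normc (cauchy e z0 - cauchy e z) < a / 2.
  have dc : derivable (cauchy e) z0 1.
    have quad := cauchy_quadratic (FU := FU) s r0_gt0 e z00.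
    apply: (quadratic_derivable _ _ quad).
      by rewrite !mulr_ge0 ?exprn_ge0 ?invr_ge0 ?subr_ge0 ?(ltW r0_gt0) ?(ltW z00).
    by rewrite divr_gt0// subr_gt0.
  have /(cvg_normcP (FF := nbhs_filter z0)) := derivable_continuous dc.
  by apply; rewrite divr_gt0.
have hr : \forall z \near z0, disc z0 (r0 / 2) z by exact: nbhs_disc.
pose eta := a / (8 * ((m%:R + 1) * (K + 1))).
have mK0 : 0 < (m%:R + 1) * (K + 1) by rewrite mulr_gt0// ltr_wpDl.
have eta0 : 0 < eta by rewrite divr_gt0// mulr_gt0.
have heta : \forall z \near z0, disc z0 eta z by exact: nbhs_disc.
near=> z.
have h1 : normc (cauchy e z0 - cauchy e z) < a / 2 by near: z.
have h2 : disc z0 (r0 / 2) z by near: z.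
have h3 : disc z0 eta z by near: z.
rewrite /disc/= in h2 h3.
have zr0 : normc (z - z0) < r0 by lra.
have ca : a / 2 < normc (cauchy e z).
  have := normcD (cauchy e z0 - cauchy e z) (cauchy e z).
  have na : normc (cauchy e z0) = a by rewrite c0 normcN.
  by rewrite subrK na; lra.
split; first exact: ltW.
  by rewrite -normc_gt0; lra.
apply: (@lt_le_trans _ _ (a / 8)); last by lra.
have cK : normc (cauchy' e z) <= K.
  apply: outer_lim_le K0 _ => w wo.
  apply: le_trans (bounded_cauchy' r0_gt0 e zr0 wo) _.
  rewrite ler_wpM2l ?exprn_ge0 ?invr_ge0 ?(ltW r0_gt0)//.
  have d2 : r0 / 2 <= r0 - normc (z - z0) by lra.
  have d0 : 0 < r0 - normc (z - z0) by lra.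
  by rewrite lerXn2r ?nnegrE ?invr_ge0 ?(ltW r2) ?(ltW d0)// lef_pV2 ?posrE.
have n0 := normc_ge0 (z - z0).
apply: (@le_lt_trans _ _ (normc (z - z0) * ((m%:R + 1) * (K + 1)))).
  rewrite mulrAC mulrC ler_wpM2l// ler_pM ?normc_ge0//; first by rewrite lerDl.
  by rewrite (le_trans cK)// lerDl.
have -> : a / 8 = eta * ((m%:R + 1) * (K + 1)).
  by rewrite /eta; field; rewrite !gt_eqF// ltr_wpDl.
by rewrite ltr_pM2r.
Unshelve. all: by end_near. Qed.

(** The limit is - m v l_1 / l_0 = m v g'/g with g = [cauchy 0], and v g'/g = e + v h'/h with
h = [cauchy e]. *)
Lemma logderiv_diff_cvg (u : nat -> C) (v : C) r : 0 < r -> r <= r0 / 2 ->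
  (\forall k \near F, normc (u k) = r) -> u @ F --> v -> normc v = r ->
  cauchy e (z0 + v) != 0 ->
  (\forall k \near F, (q k).[z0 + u k] != 0) /\
  (\forall k \near F, (q k)^`(m).[z0 + u k] != 0) /\
  (fun k => u k * ((q k)^`(m)^`().[z0 + u k] / (q k)^`(m).[z0 + u k] -
                   (q k)^`().[z0 + u k] / (q k).[z0 + u k])) @ F -->
  ((m * e)%:R + m%:R * v * cauchy' e (z0 + v) / cauchy e (z0 + v) : C).
Proof.
move=> r_gt0 rr0 ur uv vr ce0; have [r0_gt0 _] := cluster.
have r2 : 0 < r / 2 by rewrite divr_gt0.
have r2r0 : r / 2 <= r0 by lra.
have rr : r < r0 by lra.
have uD w : z0 + w - z0 = w by rewrite addrC addKr.
have v0 : v != 0 by rewrite -normc_gt0 vr.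
have qn : \forall k \near F, (q k).[z0 + u k] != 0.
  apply: near_imp (near_and ur (inner_roots_close r2 r2r0)) => k [uk close].
  apply/negP; rewrite -[_ == 0]/(root _ _) -mem_poly_roots// => /close.
  by rewrite uD uk => /(_ rr); lra.
split; first exact: qn.
have zr : normc (z0 + v - z0) < r0 by rewrite uD vr.
pose l i := outer_lim F s z0 r0 (fun w => (z0 + v - w)^-1 ^+ i.+1).
have l0E : l 0%N = cauchy 0 (z0 + v).
  by apply: eq_outer_lim => w _; rewrite expr0 mul1r.
have l1E : l 1%N = - cauchy' 0 (z0 + v).
  rewrite -mulN1r -(outer_limZ s (-1) (bounded_cauchy' r0_gt0 0 zr)).
  by apply: eq_outer_lim => w _; rewrite expr0 mul1r mulrN mulN1r opprK.
have [c0 c1] := cauchy_factor (FU := FU) r0_gt0 zr moment_lt.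
rewrite !uD in c0 c1.
have l00 : l 0%N != 0 by rewrite l0E c0 mulf_neq0// expf_neq0.
have n0 k : (size (poly_roots (q k)))%:R != 0 :> C by rewrite pnatr_eq0 -lt0n.
have ucvg : (fun k => z0 + u k) @ F --> (z0 + v : C) by exact: cvg_addC (cvg_cst _) uv.
have pcvg i : (fun k => psum (inverse_dists (q k) (z0 + u k)) i.+1 /
    (size (poly_roots (q k)))%:R) @ F --> l i.
  apply: (@psum_cvg _ _ r) => //; first by rewrite uD vr.
  by apply: near_imp ur => k; rewrite uD.
have [h1 h2] := cvg_logderiv_derivn m n0 inv_size_cvg0 qn pcvg l00.
split; first exact: h1.
have /(_ _) := cvg_mulC uv h2; rewrite l1E l0E.
have -> : v * - (m%:R * - cauchy' 0 (z0 + v) / cauchy 0 (z0 + v)) =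
    (m * e)%:R + m%:R * v * cauchy' e (z0 + v) / cauchy e (z0 + v).
  have -> : v * - (m%:R * - cauchy' 0 (z0 + v) / cauchy 0 (z0 + v)) =
    m%:R * (v * cauchy' 0 (z0 + v)) / cauchy 0 (z0 + v) by ring.
  rewrite c1 c0 natrM; field; rewrite ce0 expf_neq0//.
exact.
Qed.

(** On a small circle the difference of the logarithmic derivatives, times u, must
eventually be within 1/2 of m e. If not, choose bad points u k on the circle; along F
they converge to some v, and the limit there is within 1/4 of m e. The argument
principle then compares the root counts, which are integers. *)
Lemma cluster_count_derivn :
  cluster_count F (fun k => poly_roots (q k)^`(m)) z0 (d + m * e)%N.
Proof.
have [r0_gt0 hd] := cluster; have [r2 r2_gt0 hr2] := (nbhs_discP _ _).1 cauchy_nbhs.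
exists (Num.min (r2 / 2) (r0 / 2)); split; first by rewrite lt_min !divr_gt0.
move=> r r_gt0; rewrite le_min => /andP[rr2 rr0].
pose good k u := [/\ (q k)^`(m).[z0 + u] != 0, (q k).[z0 + u] != 0 &
  normc (u * ((q k)^`(m)^`().[z0 + u] / (q k)^`(m).[z0 + u] -
              (q k)^`().[z0 + u] / (q k).[z0 + u]) - (m * e)%:R) <= 2^-1].
have circle : \forall k \near F, forall u, normc u = r -> good k u.
  apply: contrapT => /ultra_nearN bad.
  (* u k is a point of the circle that is not good, whenever there is one. *)
  have /choice[u uP] : forall k, exists u,
      ~ (forall u, normc u = r -> good k u) -> normc u = r /\ ~ good k u.
    move=> k; have [h|h] := pselect (forall u, normc u = r -> good k u).
      by exists 0 => /(_ h).
    by move/existsNP: h => [u /not_implyP[ur ug]]; exists u.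
  have ur : \forall k \near F, normc (u k) = r.
    by apply: near_imp bad => k /uP[].
  have ur' : \forall k \near F, normc (u k) <= r by apply: near_imp ur => k ->.
  have [v _ uv] := ultra_cvg_bounded FU ur'.
  have vr : normc v = r.
    apply/eqP; rewrite -subr_eq0 -normr_eq0 -[_ == 0]negbK; apply/negP => vr.
    have vr0 : 0 < `|normc v - r| by rewrite lt_def vr normr_ge0.
    have /cvg_normcP/(_ _ vr0) uv' := uv.
    have [k [uk1 uk2]] := near_ex (near_and uv' ur).
    move: uk1; rewrite -uk2 ltNge => /negP; apply.
    rewrite ler_norml; have h1 := normcD (v - u k) (u k).
    have h2 := normcD (u k - v) v; rewrite !subrK (normcB _ v) in h1 h2.
    by apply/andP; split; lra.
  have uD : z0 + v - z0 = v by rewrite addrC addKr.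
  have [_ ce0 small] : [/\ normc (z0 + v - z0) <= r0 / 2, cauchy e (z0 + v) != 0 &
      m%:R * normc (z0 + v - z0) * normc (cauchy' e (z0 + v)) <
      normc (cauchy e (z0 + v)) / 4].
    by apply: hr2; rewrite /disc/= uD vr; lra.
  rewrite uD in small.
  have [h1 [h2 /cvg_normcP h3]] := logderiv_diff_cvg r_gt0 rr0 ur uv vr ce0.
  have q4 : 0 < (4^-1 : R) by rewrite invr_gt0.
  have [k [[[[h1k h2k] h3k] ck] _]] := near_ex (near_and (near_and (near_and
    (near_and h1 h2) (h3 _ q4)) bad) ur).
  have [_] := uP k ck; apply; split => //.
  move: h3k; set X := u k * _; set Y := _ / _ => h3k.
  have Y4 : normc Y < 4^-1.
    rewrite /Y normc_div !normcM normc_nat ltr_pdivrMr ?normc_gt0// [4^-1 * _]mulrC.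
    exact: small.
  have -> : X - (m * e)%:R = Y - ((m * e)%:R + Y - X) by ring.
  apply: le_trans (normcD _ _) _; rewrite normcN.
  have -> : (2^-1 : R) = 4^-1 + 4^-1 by field.
  exact: lerD (ltW Y4) (ltW h3k).
have rr0' : r <= r0 by lra.
apply: near_imp (near_and circle (hd r r_gt0 rr0')) => k [ck dk].
have p1 : (q k)^`(m) != 0.
  have [|h _ _] := ck r%:C; first by rewrite normc_real ger0_norm// ltW.
  by apply: contraNneq h => ->; rewrite horner0.
have h : normc ((disc_count (poly_roots (q k)^`(m)) z0 r)%:R -
    (disc_count (poly_roots (q k)) z0 r)%:R - (m * e)%:R : C) <= 2^-1.
  exact: disc_count_diff.
rewrite dk in h; set c1 := disc_count _ _ _ in h *.
have : normc ((c1%:R - (d + m * e)%:R)%:C : C) <= 2^-1.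
  apply: le_trans h; rewrite rmorphB !rmorph_nat natrD.
  by rewrite opprD addrA.
rewrite normc_real; case: (ltngtP c1 (d + m * e)%N) => // hc.
  have : (c1%:R + 1 <= (d + m * e)%:R :> R) by rewrite natr1 ler_nat.
  by rewrite ler_norml => ? /andP[? ?]; exfalso; lra.
have : ((d + m * e)%:R + 1 <= c1%:R :> R) by rewrite natr1 ler_nat.
by rewrite ler_norml => ? /andP[? ?]; exfalso; lra.
Qed.

End PowerSums.

Section LocalCount.
Context {R : realType}.
Local Notation C := (plane R).
Local Notation B := (borel_plane R).
Variables (q : nat -> {poly R[i]}) (mu : probability B R) (U : set C).
Hypothesis q_monic : forall k, q k \is monic.
Hypothesis degq_gt0 : forall k, (0 < (size (q k)).-1)%N.
Hypothesis degq_infty : (size (q k)).-1 @[k --> \oo] --> \oo.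
Hypothesis weak_cvg : weak_star_cvg (fun k => root_distribution (q k)) mu.
Hypothesis mu_support : compact (measure_support mu).
Hypothesis U_open : open U.
Hypothesis U_sparse : root_sparse q U.
Hypothesis U_nonconstant : nowhere_locally_constant U (potential mu).
Implicit Types (z w : C).

Lemma few_roots_disc z : U z -> exists r, exists N,
  [/\ 0 < r, disc z r `<=` U &
      \forall k \near \oo, (disc_count (poly_roots (q k)) z r <= N)%N].
Proof.
move=> Uz; have /nbhs_discP[r r_gt0 rU] := open_nbhs_nbhs (conj U_open Uz).
have r2 : 0 < r / 2 by rewrite divr_gt0.
have KU : [set w : C | normc (w - z) <= r / 2] `<=` U.
  by move=> w /= wr; apply: rU; rewrite /disc/=; lra.
have [M hM] := U_sparse (@compact_cdisc R z (r / 2)) KU.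
exists (r / 2), (Num.trunc M).+1; split => //.
  by move=> w wr; apply: KU; exact: ltW.
apply: near_imp hM => k; rewrite root_countingE lee_fin => hk.
have cM : (disc_count (poly_roots (q k)) z (r / 2))%:R <= M.
  apply: le_trans hk; rewrite ler_nat; apply: sub_count => w /ltW wr.
  by rewrite inE.
rewrite -(ler_nat R); apply: (le_trans cM); apply/ltW; exact: truncnS_gt.
Qed.

Variable F : set_system nat.
Context {FU : UltraFilter F}.
Hypothesis ooF : \oo `<=` F.

(** Here e is the least index of a nonzero moment. If all moments vanished, the
potential would be constant on a disc contained in U. The multiplicity d is that of
the cluster of the roots of q_k. *)
Lemma local_count z0 : U z0 -> exists d, forall m,
  cluster_count F (fun k => poly_roots (q k)^`(m)) z0
    (d + m * zero_order (potential_deriv mu) z0)%N.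
Proof.
move=> Uz0; have [r [N [r_gt0 rU hN]]] := few_roots_disc Uz0.
have [d _ [r0 r0r cl]] := cluster_count_ex FU r_gt0 (ooF hN).
have [r0_gt0 _] := cl.
have hN0 : \forall k \near \oo, (disc_count (poly_roots (q k)) z0 r0 <= N)%N.
  apply: near_imp hN => k; apply: leq_trans; apply: disc_count_le => w wr.
  exact: lt_le_trans r0r.
pose P z := fine (potential mu z).
have PE z := @potential_diff_outer_lim R q mu q_monic degq_gt0 degq_infty weak_cvg
  z0 r0 N r0_gt0 hN0 mu_support F FU z ooF.
have Pfin z := @potential_fin_num R q mu degq_gt0 degq_infty weak_cvg
  z0 r0 N r0_gt0 hN0 mu_support z.
have moment_ex : exists e, moment F (fun k => poly_roots (q k)) z0 r0 e != 0.
  apply: contrapT => m0.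
  have {}m0 j : moment F (fun k => poly_roots (q k)) z0 r0 j = 0.
    by apply/eqP/negPn/negP => h; apply: m0; exists j.
  have r8 : 0 < r0 / 8 by rewrite divr_gt0.
  have Dz0 : disc z0 (r0 / 8) !=set0 by exists z0; rewrite /disc/= subrr normc0.
  have DU : disc z0 (r0 / 8) `<=` U.
    by move=> w /= wr; apply: rU; move: wr; rewrite /disc/=; lra.
  apply: (U_nonconstant (@open_disc R z0 (r0 / 8)) Dz0 DU).
  exists (potential mu z0) => z zr.
  rewrite -(fineK (Pfin z zr)) -(fineK (Pfin z0 _)) ?subrr ?normc0//.
  congr (_%:E); apply: (potential_constant r0_gt0 PE _ zr) => w wr.
  by apply: cauchy0_eq0 => //; lra.
have [e me mmin] := ex_minnP moment_ex.
have mlt j : (j < e)%N -> moment F (fun k => poly_roots (q k)) z0 r0 j = 0.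
  by move=> je; apply/eqP; apply: contraTT je => /mmin; rewrite -leqNgt.
exists d => m; rewrite (zero_order_two_dz r0_gt0 PE me mlt).
apply: (cluster_count_derivn _ _ _ cl m me mlt).
- by move=> k; rewrite monic_neq0.
- by move=> k; rewrite size_poly_roots ?monic_neq0.
have h := cvg_trans (cvg_app _ ooF) (inv_degree_cvg0 degq_gt0 degq_infty).
have := cvg_comp _ _ h (@continuous_real_complex R _).
apply: cvg_trans; apply: near_eq_cvg; apply: nearW => k /=.
by rewrite size_poly_roots ?monic_neq0// fmorphV rmorph_nat.
Qed.

End LocalCount.

(** * Divisors *)

Section Divisors.
Context {R : realType}.
Local Notation C := (plane R).

Lemma derivn_neq0 (p : {poly R[i]}) m : p \is monic -> (m <= (size p).-1)%N ->
  p^`(m) != 0.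
Proof.
move=> pm mp; apply/eqP => /(congr1 (fun r : {poly _} => r`_((size p).-1 - m))).
rewrite coef_derivn coef0 subnKC// (_ : p`__ = 1); last exact/monicP.
by apply/eqP; rewrite pnatr_eq0 -lt0n ffact_gt0.
Qed.

(** Collects equal terms: it compares a sum over roots with a sum against a divisor. *)
Lemma sum_count_mem (s zs : seq C) (phi : C -> C) : uniq zs ->
  (forall w, w \in s -> phi w != 0 -> w \in zs) ->
  \sum_(w <- s) phi w = \sum_(z <- zs) (count_mem z s)%:R * phi z.
Proof.
move=> uzs szs.
transitivity (\sum_(z <- zs) \sum_(w <- s | w == z) phi w); last first.
  apply: eq_bigr => z _; rewrite (eq_bigr (fun=> phi z)) => [|w /eqP ->//].
  by rewrite big_const_seq iter_addr_0 mulr_natl.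
rewrite (exchange_big_dep xpredT)//=; apply: eq_big_seq => w ws.
have [->|pw] := eqVneq (phi w) 0; first by rewrite big1.
rewrite big_mkcond (bigD1_seq w)/= ?szs// eqxx big1 ?addr0// => z zw.
by rewrite eq_sym (negbTE zw).
Qed.

Lemma is_divisor_near (U : set C) (xi : C -> int) :
  (forall z, U z -> \forall w \near z, U w -> w != z -> xi w = 0) -> is_divisor U xi.
Proof.
move=> h z /h hz /(_ _ hz)[w [wz [Uw xiw] /(_ Uw wz)]].
by move/eqP: xiw.
Qed.

Lemma is_divisor_roots (U : set C) (p1 p2 : {poly R[i]}) : p1 != 0 -> p2 != 0 ->
  is_divisor U (fun z => divisor_of (horner p1) z - divisor_of (horner p2) z).
Proof.
move=> p10 p20; apply: is_divisor_near => z _.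
have : \forall w \near z, forall u : C, u \in poly_roots p1 ++ poly_roots p2 ->
    u != z -> w != u.
  apply: (near_seq (FF := nbhs_filter z)) => u _; have [->|uz] := eqVneq u z.
    by near=> w.
  have d0 : 0 < normc (u - z) by rewrite normc_gt0 subr_eq0.
  apply: near_imp (nbhs_disc z d0) => w wd _; apply: contraTneq (wd) => ->.
  by rewrite ltxx.
apply: (near_imp (FF := nbhs_filter z)) => w hw _ wz; rewrite /divisor_of !zero_order_horner//.
have : w \notin poly_roots p1 ++ poly_roots p2.
  by apply/negP => /hw/(_ wz); rewrite eqxx.
by rewrite mem_cat negb_or => /andP[/count_memPn -> /count_memPn ->].
Unshelve. all: by end_near. Qed.

(** The order of the zero of a polynomial at z is the multiplicity of z in its list of
roots. *)
Lemma divisor_act_roots (U : set C) (p1 p2 : {poly R[i]}) (phi : C -> C) :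
  p1 != 0 -> p2 != 0 -> (forall w, phi w != 0 -> U w) ->
  divisor_act U (fun z => divisor_of (horner p1) z - divisor_of (horner p2) z) phi =
  \sum_(w <- poly_roots p1) phi w - \sum_(w <- poly_roots p2) phi w.
Proof.
move=> p10 p20 pU.
pose zs := undup [seq w <- poly_roots p1 ++ poly_roots p2 | phi w != 0].
have uzs : uniq zs by exact: undup_uniq.
have zsE w : (w \in zs) = (phi w != 0) && ((w \in poly_roots p1) || (w \in poly_roots p2)).
  by rewrite mem_undup mem_filter mem_cat.
rewrite (@sum_count_mem (poly_roots p1) zs)// => [|w ws pw]; last by rewrite zsE pw ws.
rewrite (@sum_count_mem (poly_roots p2) zs)// => [|w ws pw]; last first.
  by rewrite zsE pw ws orbT.
rewrite -sumrB /divisor_act (@fsbig_uniq_seq R U zs)// => [|z|z Uz].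
- apply: eq_bigr => z _; rewrite /divisor_of !zero_order_horner//.
  by rewrite rmorphB /= !pmulrn mulrBl.
- by rewrite zsE => /andP[/pU].
rewrite zsE negb_and negbK => /orP[/eqP ->|]; first by rewrite mulr0.
rewrite negb_or /divisor_of !zero_order_horner//.
by move=> /andP[/count_memPn -> /count_memPn ->]; rewrite subrr mul0r.
Qed.

End Divisors.

Theorem theorem1 (R : realType) (q : nat -> {poly R[i]})
    (mu : probability (borel_plane R) R) (U : set (plane R)) :
  (forall k, q k \is monic) ->
  (forall k, (0 < (size (q k)).-1)%N) ->
  (size (q k)).-1 @[k --> \oo] --> \oo ->
  weak_star_cvg (fun k => root_distribution (q k)) mu ->
  compact (measure_support mu) ->
  open U ->
  root_sparse q U ->
  nowhere_locally_constant U (potential mu) ->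
  forall m : nat,
    divisor_cvg U
      (fun k z => divisor_of (horner (q k)^`(m)) z - divisor_of (horner (q k)) z)
      (fun z => m%:Z * divisor_of (potential_deriv mu) z).
Proof.
move=> q_monic degq_gt0 degq_infty weak_cvg mu_support U_open U_sparse U_nonconstant m.
have q0 k : q k != 0 by rewrite monic_neq0.
have qm0 : \forall k \near \oo, (q k)^`(m) != 0.
  have h : \forall k \near \oo, (m <= (size (q k)).-1)%N.
    by have [+ _] := cvgnyPge (F := \oo) (fun k => (size (q k)).-1); apply.
  by apply: near_imp h => k; apply: derivn_neq0.
have local (F : set_system nat) : UltraFilter F -> \oo `<=` F ->
    exists d, forall z, U z -> forall j, cluster_count F (fun k => poly_roots (q k)^`(j)) z
      (d z + j * zero_order (potential_deriv mu) z)%N.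
  move=> FU ooF; suff /choice[d hd] : forall z, exists n, U z -> forall j,
      cluster_count F (fun k => poly_roots (q k)^`(j)) z
        (n + j * zero_order (potential_deriv mu) z)%N by exists d.
  move=> z; have [Uz|nUz] := pselect (U z); last by exists 0%N.
  have [d hd] := local_count q_monic degq_gt0 degq_infty weak_cvg mu_support
    U_open U_sparse U_nonconstant ooF Uz.
  by exists d.
split.
- by apply: near_imp qm0 => k qmk; exact: is_divisor_roots.
(* Near z there are no clusters other than z, so m times the order of p' vanishes off z. *)
- apply: is_divisor_near => z Uz; have [F [FU ooF]] := ultraFilterLemma eventually_filter.
  have [d hd] := local F FU ooF.
  have [r hr] := hd z Uz m; have [r_gt0 _] := hr.
  apply: near_imp (nbhs_disc z r_gt0) => w wr Uw wz.
  have h : (d w + m * zero_order (potential_deriv mu) w)%N = 0%N.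
    exact: (cluster_count_isolated hr wr wz (hd w Uw m)).
  move/eqP: h; by rewrite addn_eq0 => /andP[_ /eqP]; rewrite /divisor_of -PoszM => ->.
move=> phi phiU; have [_ Kc KU] := phiU.
have phi_closure z : phi z != 0 -> closure [set z | phi z != 0] z.
  by move=> pz; apply: (@subset_closure _ [set z | phi z != 0]).
apply: cvg_ultra => F FU ooF; have [d hd] := local F FU ooF.
set ord := zero_order (potential_deriv mu) in hd.
have cvgm := cvg_cluster_sum (fun z Uz => hd z Uz m) phiU.
have cvg0 := cvg_cluster_sum (fun z Uz => hd z Uz 0%N) phiU.
have -> : divisor_act U (fun z => m%:Z * divisor_of (potential_deriv mu) z) phi =
    \sum_(z \in U) (d z + m * ord z)%:R * phi z - \sum_(z \in U) (d z + 0 * ord z)%:R * phi z.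
  (* One finite list zs carries the three sums: where d + m ord vanishes, so do d and
     m ord. *)
  have [zs [rho [uzs zsK zsrho cov]]] := cluster_cover Kc KU (fun z Uz => hd z Uz m).
  have off z : U z -> z \notin zs -> phi z = 0 \/ (d z + m * ord z = 0)%N.
    move=> Uz zzs; have [->|pz] := eqVneq (phi z) 0; [by left|right].
    have [z1 z1zs zz1] := cov z (phi_closure z pz).
    apply: (cluster_count_isolated (zsrho _ z1zs) zz1 _ (hd z Uz m)).
    by apply: contraNneq zzs => ->.
  have zsU z : z \in zs -> U z by move=> /zsK/KU.
  rewrite /divisor_act !(@fsbig_uniq_seq R U zs)//
    => [|z Uz /(off z Uz)|z Uz /(off z Uz)|z Uz /(off z Uz)].
  - rewrite -sumrB; apply: eq_bigr => z _; rewrite -mulrBl; congr (_ * _).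
    by rewrite mul0n addn0 natrD [X in X - _]addrC addrK /divisor_of -PoszM.
  - by case=> [->|/eqP]; rewrite ?mulr0// mul0n addn0 addn_eq0 => /andP[/eqP -> _]; rewrite mul0r.
  - by case=> [->|->]; rewrite ?mulr0// mul0r.
  - case=> [->|/eqP]; rewrite ?mulr0// addn_eq0 => /andP[_ /eqP h].
    by rewrite /divisor_of -PoszM h mul0r.
have PF : ProperFilter F by exact: ultra_proper.
have /(_ _) := cvg_subC (cvgm PF) (cvg0 PF); apply: cvg_trans; apply: near_eq_cvg.
apply: near_imp (ooF _ qm0) => k qmk; rewrite divisor_act_roots// => w /phi_closure.
exact: KU.
Qed.
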